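(* Let $b\ge2$, $d\ge1$, $t\ge0$ be integers, and let $\mathcal S=(\boldsymbol x_n)_{n\ge0}$ be a $(t,d)$-sequence in base $b$, not necessarily digital. Suppose that, for every $m$, its first $b^m$ points satisfy the uniform coincidence bound and the uniform common-prefix cutoff with constants $A\ge1$ and $\kappa\in\mathbb N_0$ independent of $m$. Apply a single full Owen scrambling to the whole sequence, giving $(\widetilde{\boldsymbol x}_n)_{n\ge0}$, and set $\widetilde P_n=(\widetilde{\boldsymbol x}_j)_{0\le j<n}$ for $n\ge1$. Then, almost surely, $$ \frac{\log R_\infty(\widetilde P_n)}{\log n}\longrightarrow-\frac{3}{2d}, \qquad \frac{\log\rho_\infty(\widetilde P_n)}{\log n}\longrightarrow\frac{1}{2d} $$ as $n\to\infty$. In particular, the scrambled sequence is almost surely not quasi-uniform.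
   Context: For $\boldsymbol k\in\mathbb N_0^d$, let $\mathcal E_{\boldsymbol k}$ be the collection of level-$\boldsymbol k$ elementary intervals $\prod_{j=1}^d[a_jb^{-k_j},(a_j+1)b^{-k_j})$, $0\le a_j<b^{k_j}$, and $|\boldsymbol k|=k_1+\dots+k_d$; each has volume $b^{-|\boldsymbol k|}$. For $0\le t\le m$, a $(t,m,d)$-net in base $b$ is a $b^m$-point multiset in $[0,1)^d$ such that every elementary interval of volume $b^{t-m}$ contains exactly $b^t$ of its points. A $(t,d)$-sequence in base $b$ is an infinite sequence $(\boldsymbol x_n)_{n\ge0}$ in $[0,1)^d$ such that for every $k\ge0$ and $m\ge t$ the point set $\{\boldsymbol x_n:kb^m\le n<(k+1)b^m\}$ is a $(t,m,d)$-net in base $b$. For an $N$-point multiset $P_{b^m}=(\boldsymbol x_n)_{0\le n<N}$, $N=b^m$, let $\nu_m(E)=\#\{n:\boldsymbol x_n\in E\}$ and $M_m(\boldsymbol k)=\sum_{E\in\mathcal E_{\boldsymbol k}}\nu_m(E)(\nu_m(E)-1)$. (For digital points, membership is determined by the specified output-digit expansion.) - Coincidence bound with constant $A$: $M_m(\boldsymbol k)\le AN(N-1)b^{-|\boldsymbol k|}$ for all $\boldsymbol k\in\mathbb N_0^d$. - Common-prefix cutoff with parameter $\kappa$: every $E\in\mathcal E_{\boldsymbol k}$ with $|\boldsymbol k|\ge m+\kappa$ contains at most one point of $P_{b^m}$, counted with multiplicity. ''Uniform'' means the same $A$, respectively $\kappa$, works for every $m$. Full Owen scrambling in base $b$: independently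 for each coordinate $j$ and each finite digit prefix $a_1\cdots a_{r-1}\in\{0,\dots,b-1\}^{r-1}$ ($r\ge1$), choose a uniform random permutation $\pi_{j,a_1\cdots a_{r-1}}$ of $\{0,\dots,b-1\}$, all mutually independent. The $j$-th coordinate with base-$b$ digits $(a_r)_{r\ge1}$ (regular expansion, not ending in infinitely many digits $b-1$; for digital points, the specified output digits) is replaced by the number with digits $\widetilde a_r=\pi_{j,a_1\cdots a_{r-1}}(a_r)$. A single scrambling uses the same permutations for all points of the sequence. For an $N$-point multiset $P=(\boldsymbol x_n)_{0\le n<N}$ in $[0,1]^d$ with $N\ge2$: $R_\infty(P)=\min_{n<n'}\|\boldsymbol x_n-\boldsymbol x_{n'}\|_\infty$, $h_\infty(P)=\sup_{\boldsymbol z\in[0,1]^d}\min_{n}\|\boldsymbol z-\boldsymbol x_n\|_\infty$, $\rho_\infty(P)=2h_\infty(P)/R_\infty(P)$ ($=\infty$ if $R_\infty(P)=0$). A sequence is quasi-uniform if the supremum over $N\ge2$ of $\rho_\infty$ of its first $N$ points is finite. *)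

(* Defs.v *)
From HB Require Import structures.
From mathcomp Require Import all_boot all_order all_fingroup all_algebra.
From mathcomp Require Import all_classical all_reals all_analysis.

Set Implicit Arguments.
Unset Strict Implicit.
Unset Printing Implicit Defensive.

Import Order.TTheory GRing.Theory Num.Theory.
Import numFieldNormedType.Exports.
Local Open Scope classical_set_scope.
Local Open Scope ring_scope.

(** Digits are indexed from 0: [e r] is the coefficient of b^-(r+1). *)
Definition digits_value (R : realType) (b : nat) (e : nat -> 'I_b) : R :=
  limn (series (fun r => (e r)%:R / b%:R ^+ r.+1 : R)).

(** For 0 <= x < 1 this is the expansion of x that does not end in infinitely
    many digits b-1. *)
Definition regular_digit (R : realType) (b : nat) (hb : (1 < b)%N) (x : R)
    (r : nat) : 'I_b :=
  Ordinal (ltn_pmod (Num.truncn (x * b%:R ^+ r.+1)) (ltnW hb)).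

(** The integer whose base-b digits are the first [r] digits of [e]. *)
Definition prefix_index (b : nat) (e : nat -> 'I_b) (r : nat) : nat :=
  (\sum_(i < r) e i * b ^ (r - i.+1))%N.

(** A point either is used through its regular expansion ([out_digits = None])
    or, as for digital points, comes with specified output digits, which may
    end in infinitely many digits b-1. *)
Record bpoint (R : realType) (b d : nat) := BPoint {
  coord : 'rV[R]_d;
  out_digits : option ('I_d -> nat -> 'I_b)
}.

Definition wf_bpoint (R : realType) (b d : nat) (p : bpoint R b d) : Prop :=
  (forall j, 0 <= coord p 0 j < 1) /\
  (if out_digits p is Some e
   then forall j, digits_value R (e j) = coord p 0 j else True).

Definition digits (R : realType) (b d : nat) (hb : (1 < b)%N)
    (p : bpoint R b d) (j : 'I_d) (r : nat) : 'I_b :=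
  if out_digits p is Some e then e j r else regular_digit hb (coord p 0 j) r.

Definition elementary_interval (R : realType) (b d : nat) (k : 'I_d -> nat)
    (a : 'I_d -> nat) : set 'rV[R]_d :=
  [set z | forall j,
     (a j)%:R / b%:R ^+ k j <= z 0 j < (a j).+1%:R / b%:R ^+ k j].

(** Level-k elementary intervals correspond bijectively to their indices. *)
Definition elem_index (b d : nat) (k : 'I_d -> nat) : finType :=
  {dffun forall j : 'I_d, 'I_(b ^ k j)}.

Definition level_sum (d : nat) (k : 'I_d -> nat) : nat := (\sum_j k j)%N.

Definition in_elem (R : realType) (b d : nat) (p : bpoint R b d)
    (k : 'I_d -> nat) (a : elem_index b k) : bool :=
  if out_digits p is Some e
  then [forall j, prefix_index (e j) (k j) == a j]
  else coord p \in elementary_interval b k (fun j => a j).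

Definition elem_count (R : realType) (b d N : nat) (P : 'I_N -> bpoint R b d)
    (k : 'I_d -> nat) (a : elem_index b k) : nat :=
  #|[set n : 'I_N | in_elem (P n) a]%SET|.

(** The intervals of volume b^(t-m) are those of level k with
    |k| = m - t. *)
Definition tmd_net (R : realType) (b t m d : nat)
    (P : 'I_(b ^ m) -> bpoint R b d) : Prop :=
  [/\ (t <= m)%N,
      (forall n, wf_bpoint (P n)) &
      forall (k : 'I_d -> nat) (a : elem_index b k),
        level_sum k = (m - t)%N -> elem_count P a = (b ^ t)%N].

Definition td_sequence (R : realType) (b t d : nat)
    (x : nat -> bpoint R b d) : Prop :=
  (forall n, wf_bpoint (x n)) /\
  forall k m : nat, (t <= m)%N ->
    tmd_net t (fun n : 'I_(b ^ m) => x (k * b ^ m + n)%N).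

Definition coincidences (R : realType) (b d N : nat)
    (P : 'I_N -> bpoint R b d) (k : 'I_d -> nat) : nat :=
  (\sum_(a : elem_index b k) elem_count P a * (elem_count P a - 1))%N.

Definition coincidence_bound (R : realType) (b d N : nat) (A : R)
    (P : 'I_N -> bpoint R b d) : Prop :=
  forall k : 'I_d -> nat,
    (coincidences P k)%:R <= A * N%:R * (N%:R - 1) / b%:R ^+ level_sum k.

Definition prefix_cutoff (R : realType) (b d m kappa : nat)
    (P : 'I_(b ^ m) -> bpoint R b d) : Prop :=
  forall (k : 'I_d -> nat) (a : elem_index b k),
    (m + kappa <= level_sum k)%N -> (elem_count P a <= 1)%N.

Definition first_points (T : Type) (x : nat -> T) (N : nat) : 'I_N -> T :=
  fun n => x n.

(** The family is indexed by a coordinate and a finite digit prefix (the empty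
    prefix gives the permutation of the first digit).  A random permutation is
    a function on the sample space with measurable fibres. *)
Definition owen_family (disp : measure_display) (Omega : measurableType disp)
    (R : realType) (Pr : probability Omega R) (b d : nat)
    (pi : 'I_d -> seq 'I_b -> Omega -> {perm 'I_b}) : Prop :=
  [/\ (forall j u s, measurable [set w | pi j u w = s]),
      (forall j u s, Pr [set w | pi j u w = s] = ((b`!)%:R^-1)%:E) &
      forall (I : seq ('I_d * seq 'I_b))
             (B : 'I_d * seq 'I_b -> {set {perm 'I_b}}),
        uniq I ->
        Pr [set w | forall i, i \in I -> pi i.1 i.2 w \in B i] =
        (\prod_(i <- I) Pr [set w | pi i.1 i.2 w \in B i])%E].

Definition scramble (R : realType) (b d : nat) (hb : (1 < b)%N)
    (pi : 'I_d -> seq 'I_b -> {perm 'I_b}) (p : bpoint R b d) : 'rV[R]_d :=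
  \row_j digits_value R
    (fun r => pi j (mkseq (digits hb p j) r) (digits hb p j r)).

(** The norm of ['rV[R]_d] is the sup norm.  For N >= 2 the sets below are
    nonempty and bounded, and those indexed by points are finite, so that
    [inf] is a minimum; for N < 2 the values are meaningless. *)
Definition separation (R : realType) (d : nat) (x : nat -> 'rV[R]_d)
    (N : nat) : R :=
  inf [set r | exists n n' : nat, (n < n' < N)%N /\ r = `|x n - x n'|].

Definition unit_cube (R : realType) (d : nat) : set 'rV[R]_d :=
  [set z | forall j, 0 <= z 0 j <= 1].

Definition covering_radius (R : realType) (d : nat) (x : nat -> 'rV[R]_d)
    (N : nat) : R :=
  sup [set inf [set `|z - x n| | n in `I_N] | z in @unit_cube R d].

Definition mesh_ratio (R : realType) (d : nat) (x : nat -> 'rV[R]_d)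
    (N : nat) : \bar R :=
  if separation x N == 0 then +oo%E
  else (2 * covering_radius x N / separation x N)%:E.

Definition quasi_uniform (R : realType) (d : nat) (x : nat -> 'rV[R]_d)
    : Prop :=
  (ereal_sup [set mesh_ratio x N | N in [set N | (2 <= N)%N]] < +oo)%E.

(* Main.v *)
Require Import Defs.
From HB Require Import structures.
From mathcomp Require Import all_boot all_order all_fingroup all_algebra.
From mathcomp Require Import all_classical all_reals all_analysis.
From mathcomp Require Import zify ring lra.

Set Implicit Arguments.
Unset Strict Implicit.
Unset Printing Implicit Defensive.

Import Order.TTheory GRing.Theory Num.Theory.
Import numFieldNormedType.Exports.
Local Open Scope classical_set_scope.
Local Open Scope ring_scope.

(* [prefix_index] is also a lemma on sequences. *)
Local Notation prefix_index := Defs.prefix_index.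

(** Scrambling relabels the tree of digits at random, separately in every
    coordinate. Consider two points whose digits in coordinate [j] first differ
    at position [c_j]. If their scrambled coordinates are closer than [b ^ - r]
    and [c_j < r], the two numbers formed by the first [r] digits are
    neighbouring integers, and this forces all digits of both after position
    [c_j]: they are [b - 1] for the smaller number and [0] for the larger one
    (straddle_of_close). These digits are governed by independent permutations,
    so that this has probability of order [b ^ (2 * c_j - 2 * r)]
    (weight_straddle), and the coordinates are independent.

    No pair is too close. The probability that two of the first [N = b ^ m]
    points are closer than [b ^ - r] is at most of order
    [b ^ (- 2 * d * r)] times the sum of [b ^ (2 * |c|)] over all pairs. By the
    coincidence bound there are at most of order [N ^ 2 * b ^ (- |k|)] pairs
    that agree to level [k], and by the cutoff none when [|k| >= m + kappa]; so
    the probability is of order [(r + 1) ^ d * N ^ 3 * b ^ (- 2 * d * r)]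
    (close_event_prob), which is summable when [r] is a fixed proportion above
    [3 * m / (2 * d)].

    Some pair is close. By the net property, each of the [b ^ (d * k)] boxes of
    level [(k, ..., k)] contains a point of each of the first two blocks of
    length [b ^ (d * k + t)]. By the cutoff these two points have few further
    common digits, so the event that they are neighbours at scale [b ^ - r] has
    probability of order [p ^ d], where [p = b ^ (2 * k - 2 * r)]. The events
    of two boxes interact only through the coordinates in which the boxes share
    their prefix, and ignoring such a coordinate costs a factor [1 / p]. By
    Chebyshev's inequality (second_moment) the probability that none of the
    events occurs is of order [1 / (b ^ k * p) = b ^ (2 * r - 3 * k)]
    (close_pair_exists), which is summable when [r] is a fixed proportion below
    [3 * k / 2].

    The covering radius needs no probability. Scrambling permutes the boxes of
    level [(k, ..., k)], so that every one of them keeps a point and the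
    covering radius is at most [b ^ - k] (covering_radius_net), while fewer than
    [b ^ (d * k)] points cannot have covering radius below [b ^ - k / 2]
    (covering_radius_grid). So it is of order [n ^ (- 1 / d)].

    By the Borel-Cantelli lemma the two bounds on the separation hold almost
    surely along a geometric sequence of indices, for every one of countably
    many proportions that tend to [1]. Monotonicity interpolates between these
    indices, at the price of a bounded term in the logarithm, and the exponents
    [- 3 / (2 * d)] and [- 1 / d + 3 / (2 * d) = 1 / (2 * d)] follow. The last
    one being positive, the mesh ratio is unbounded. *)

(** * Digit prefixes *)

Lemma prefix_indexS (b : nat) (e : nat -> 'I_b) (r : nat) :
  prefix_index e r.+1 = (prefix_index e r * b + e r)%N.
Proof.
rewrite /prefix_index big_ord_recr /= subnn expn0 muln1; congr addn.
rewrite big_distrl /=; apply: eq_bigr => i _.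
by rewrite subSn ?ltn_ord// expnSr mulnA.
Qed.

Lemma prefix_index_lt (b : nat) (e : nat -> 'I_b) (r : nat) :
  (prefix_index e r < b ^ r)%N.
Proof.
elim: r => [|r IH]; first by rewrite /prefix_index big_ord0.
rewrite prefix_indexS expnSr.
have := ltn_ord (e r); nia.
Qed.

Lemma prefix_index_inj (b : nat) (e f : nat -> 'I_b) (r : nat) :
  prefix_index e r = prefix_index f r <-> (forall i, (i < r)%N -> e i = f i).
Proof.
split=> [|ef]; last by apply: eq_bigr => i _; rewrite ef.
elim: r => // r IH; rewrite !prefix_indexS.
have := ltn_ord (e r); have := ltn_ord (f r) => fb eb H.
have H1 : prefix_index e r = prefix_index f r by nia.
have H2 : e r = f r by apply: val_inj => /=; lia.
by move=> i; rewrite ltnS leq_eqVlt => /orP[/eqP->//|]; apply: IH.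
Qed.

Lemma eq_mkseq_prefix (T : Type) (e f : nat -> T) (r : nat) :
  mkseq e r = mkseq f r <-> (forall i, (i < r)%N -> e i = f i).
Proof.
split=> [H i ir|H]; last first.
  by apply/eq_in_map => // i; rewrite mem_iota => /andP[_]; apply: H.
by rewrite -(nth_mkseq (e 0%N) e ir) H nth_mkseq.
Qed.

(** Truncation commutes with dropping digits: [truncn (x * b ^ r)] is the
    quotient of [truncn (x * b ^ r.+1)] by [b]. *)
Lemma prefix_index_regular (R : realType) (b : nat) (hb : (1 < b)%N) (x : R)
    (r : nat) : 0 <= x < 1 ->
  prefix_index (regular_digit hb x) r = Num.truncn (x * b%:R ^+ r).
Proof.
move=> /andP[x0 x1]; elim: r => [|r IH].
  rewrite /prefix_index big_ord0 expr0 mulr1.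
  by apply/esym/truncn_def; rewrite x0 x1.
rewrite prefix_indexS IH /=.
set m := Num.truncn (x * _ ^+ r); set M := Num.truncn _.
have b0 : 0 < b%:R :> R by rewrite ltr0n; lia.
have xb n : 0 <= x * b%:R ^+ n by rewrite mulr_ge0// exprn_ge0// ltW.
have /andP[m1 m2] : m%:R <= x * b%:R ^+ r < m.+1%:R by rewrite truncn_itv.
have /andP[M1 M2] : M%:R <= x * b%:R ^+ r.+1 < M.+1%:R by rewrite truncn_itv.
have E : x * b%:R ^+ r.+1 = x * b%:R ^+ r * b%:R by rewrite exprSr mulrA.
have L1 : (m * b < M.+1)%N.
  by rewrite -(ltr_nat R) natrM; apply: le_lt_trans M2; rewrite E ler_pM2r.
have L2 : (M < m.+1 * b)%N.
  by rewrite -(ltr_nat R) natrM; apply: le_lt_trans M1 _; rewrite E ltr_pM2r.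
have -> : m = (M %/ b)%N.
  have := divn_eq M b; have := ltn_pmod M (ltnW hb); nia.
by rewrite -divn_eq.
Qed.

Section DigitsValue.
Variables (R : realType) (b : nat).
Hypothesis hb : (1 < b)%N.
Implicit Types e f u v : nat -> 'I_b.

Let b0 : 0 < b%:R :> R. Proof. by rewrite ltr0n; lia. Qed.

Lemma series_digits e r :
  series (fun r => (e r)%:R / b%:R ^+ r.+1 : R) r
    = (prefix_index e r)%:R / b%:R ^+ r.
Proof.
elim: r => [|r IH].
  by rewrite /prefix_index /series /= big_ord0 big_geq// mul0r.
move: IH; rewrite /series /= big_nat_recr//= => ->.
rewrite prefix_indexS natrD natrM mulrDl; congr +%R.
by rewrite exprSr invfM mulrACA divff ?mulr1// gt_eqF.
Qed.

Lemma prefix_index_refine e r s : (r <= s)%N ->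
  (prefix_index e r * b ^ (s - r) <= prefix_index e s)%N /\
  (prefix_index e s < (prefix_index e r).+1 * b ^ (s - r))%N.
Proof.
move=> /subnKC <-; rewrite addKn; elim: (s - r)%N => [|n [IH1 IH2]].
  by rewrite addn0 expn0; lia.
rewrite addnS prefix_indexS expnSr; have := ltn_ord (e (r + n)%N); split; nia.
Qed.

Let partial e r s : (r <= s)%N ->
  (prefix_index e r)%:R / b%:R ^+ r
     <= series (fun r => (e r)%:R / b%:R ^+ r.+1 : R) s
     <= (prefix_index e r).+1%:R / b%:R ^+ r.
Proof.
move=> rs; rewrite series_digits; have [H1 H2] := prefix_index_refine e rs.
have p0 n : 0 < b%:R ^+ n :> R by rewrite exprn_gt0.
have E c : c%:R / b%:R ^+ r = (c * b ^ (s - r))%:R / b%:R ^+ s :> R.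
  rewrite -[in b%:R ^+ s](subnK rs) exprD natrM natrX invfM mulrA mulfK//.
  by rewrite gt_eqF.
by rewrite !E !ler_pM2r ?invr_gt0// !ler_nat H1 ltnW.
Qed.

(** The interval is closed on the right because a stream may end in infinitely
    many digits [b - 1]. *)
Lemma digits_value_bounds e r :
  (prefix_index e r)%:R / b%:R ^+ r <= digits_value R e
     <= (prefix_index e r).+1%:R / b%:R ^+ r.
Proof.
have cv : cvgn (series (fun r => (e r)%:R / b%:R ^+ r.+1 : R)).
  apply: nondecreasing_is_cvgn.
    apply/nondecreasing_series => i _ _.
    by rewrite divr_ge0// exprn_ge0// ltW.
  exists ((prefix_index e 0).+1%:R / b%:R ^+ 0) => _ [n _ <-].
  by case/andP: (@partial e 0 n (leq0n _)).
apply/andP; split.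
  by apply: limr_ge => //; exists r => // n /= rn; case/andP: (partial e rn).
by apply: limr_le => //; exists r => // n /= rn; case/andP: (partial e rn).
Qed.

Lemma digits_value_close u v r : prefix_index u r = prefix_index v r \/
   prefix_index v r = (prefix_index u r).+1 ->
  `|digits_value R u - digits_value R v| <= 2 / b%:R ^+ r.
Proof.
have p0 : 0 < b%:R ^+ r :> R by rewrite exprn_gt0.
have := digits_value_bounds u r; have := digits_value_bounds v r.
rewrite -!natr1 !mulrDl !mul1r.
have i0 : 0 < (b%:R ^+ r)^-1 :> R by rewrite invr_gt0.
move=> /andP[v1 v2] /andP[u1 u2] [E|E].
  by rewrite ler_norml; move: u1 u2; rewrite E => u1 u2; apply/andP; split; lra.
rewrite ler_norml; move: v1 v2; rewrite E -!natr1 !mulrDl !mul1r => v1 v2.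
by apply/andP; split; lra.
Qed.

(** The strict inequality matters: the cells being closed, points of cells that
    are two apart may be at distance exactly [b ^ - r]. *)
Lemma close_prefix_index u v r :
  `|digits_value R u - digits_value R v| < (b%:R ^+ r)^-1 ->
  (prefix_index v r <= (prefix_index u r).+1)%N.
Proof.
move=> H; rewrite leqNgt; apply/negP => L.
have p0 : 0 < b%:R ^+ r :> R by rewrite exprn_gt0.
have i0 : 0 < (b%:R ^+ r)^-1 :> R by rewrite invr_gt0.
have /andP[_ u2] := digits_value_bounds u r.
have /andP[v1 _] := digits_value_bounds v r.
have : (prefix_index u r).+2%:R / b%:R ^+ r <= (prefix_index v r)%:R / b%:R ^+ r :> R.
  by rewrite ler_pM2r// ler_nat.
rewrite -natr1 mulrDl mul1r => L'.
move: H; rewrite ltr_norml => /andP[H _]; lra.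
Qed.

End DigitsValue.

Section CommonPrefix.
Variable b : nat.
Implicit Types u v : nat -> 'I_b.

(** The cap [r] makes the definition total; nothing finer than the scale
    [b ^ - r] is ever looked at. *)
Definition common_prefix u v r := find (fun i => u i != v i) (iota 0 r).

Lemma common_prefix_le u v r : (common_prefix u v r <= r)%N.
Proof. by rewrite -{2}(size_iota 0 r) find_size. Qed.

Lemma common_prefix_eq u v r i : (i < common_prefix u v r)%N -> u i = v i.
Proof.
move=> H; have ir : (i < r)%N := leq_trans H (common_prefix_le _ _ _).
by have /(_ 0%N) := before_find _ H; rewrite nth_iota// => /negbFE/eqP.
Qed.

Lemma common_prefix_neq u v r : (common_prefix u v r < r)%N ->
  u (common_prefix u v r) != v (common_prefix u v r).
Proof.
move=> H; have := @nth_find _ 0%N (fun i => u i != v i) (iota 0 r).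
by rewrite has_find size_iota => /(_ H); rewrite nth_iota.
Qed.

Lemma leq_common_prefix u v k r : (k <= r)%N ->
  (forall i, (i < k)%N -> u i = v i) -> (k <= common_prefix u v r)%N.
Proof.
move=> kr H; rewrite leqNgt; apply/negP => L.
have := common_prefix_neq (leq_trans L kr).
by rewrite H ?eqxx.
Qed.

Lemma common_prefixC u v r : common_prefix u v r = common_prefix v u r.
Proof. by apply: eq_find => i; rewrite eq_sym. Qed.

Lemma eq_prefix_index_below u v c i : (forall i, (i < c)%N -> u i = v i) ->
  (i <= c)%N -> prefix_index u i = prefix_index v i.
Proof. by move=> uv ic; apply/prefix_index_inj => h hi; apply/uv/leq_trans/ic. Qed.

Lemma prefix_index_mono u v c r : (forall i, (i < c)%N -> u i = v i) ->
  (u c < v c)%N -> (c < r)%N -> (prefix_index u r < prefix_index v r)%N.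
Proof.
move=> uv lt; elim: r => // r IH; rewrite ltnS leq_eqVlt => /orP[/eqP<-|].
  rewrite !prefix_indexS (eq_prefix_index_below uv (leqnn c)); lia.
move=> /IH; rewrite !prefix_indexS.
have := ltn_ord (u r); have := ltn_ord (v r); nia.
Qed.

(** If [v] exceeds [u] by one unit in the last place, the difference is a carry
    through all positions after the first one where the digits differ: shorter
    prefixes already differ by exactly one, since a gap of two could not be made
    up by the remaining digits. *)
Lemma straddle_of_adjacent u v c r : (forall i, (i < c)%N -> u i = v i) ->
  (u c < v c)%N -> (c < r)%N -> (prefix_index v r <= (prefix_index u r).+1)%N ->
  v c = (u c).+1 :> nat /\
  (forall i, (c < i < r)%N -> u i = b.-1 :> nat /\ v i = 0%N :> nat).
Proof.
move=> uv lt; elim: r => // r IH; rewrite ltnS leq_eqVlt => /orP[/eqP<-|cr].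
  rewrite !prefix_indexS (eq_prefix_index_below uv (leqnn c)) => H.
  by split=> [|i]; lia.
have L := prefix_index_mono uv lt cr.
rewrite !prefix_indexS => H.
have := ltn_ord (u r); have := ltn_ord (v r) => vb ub.
have [|-> K] := IH cr; first by nia.
split=> // i; rewrite ltnS (leq_eqVlt i) => /andP[ci /orP[/eqP->|ir]].
  by nia.
by apply: K; rewrite ci.
Qed.

Lemma adjacent_of_straddle u v c r : (forall i, (i < c)%N -> u i = v i) ->
  v c = (u c).+1 :> nat ->
  (forall i, (c < i < r)%N -> u i = b.-1 :> nat /\ v i = 0%N :> nat) ->
  (c < r)%N -> prefix_index v r = (prefix_index u r).+1.
Proof.
move=> uv E; elim: r => // r IH H; rewrite ltnS leq_eqVlt => /orP[/eqP<-|cr].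
  by rewrite !prefix_indexS (eq_prefix_index_below uv (leqnn c)) E addnS.
rewrite !prefix_indexS IH// => [|i /andP[ci ir]]; last by apply: H; rewrite ci ltnW.
have /H[-> ->] : (c < r < r.+1)%N by rewrite cr leqnn.
by have := ltn_ord (u r); nia.
Qed.

End CommonPrefix.

Section Boxes.
Variables (R : realType) (b d : nat).
Hypothesis hb : (1 < b)%N.
Implicit Types p : bpoint R b d.

(** Whether points are used through specified digits or through their
    coordinates, membership in an elementary interval depends on digit prefixes
    only; everything below speaks of digits. *)
Lemma in_elemE p (k : 'I_d -> nat) (a : elem_index b k) (hp : wf_bpoint p) :
  in_elem p a = [forall j, prefix_index (digits hb p j) (k j) == a j].
Proof.
case: (hp) => c01 _; rewrite /in_elem /digits; case: (out_digits p) => [e|]; first by [].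
have b0 n : 0 < b%:R ^+ n :> R by rewrite exprn_gt0// ltr0n; lia.
apply/idP/forallP => [|H].
  rewrite inE => H j; rewrite prefix_index_regular//.
  have := H j; rewrite ler_pdivrMr// ltr_pdivlMr// => Hj.
  by apply/eqP/truncn_def.
rewrite inE => j; have /eqP := H j; rewrite prefix_index_regular// => <-.
rewrite ler_pdivrMr// ltr_pdivlMr//.
have /andP[c0 _] := c01 j; by rewrite truncn_itv// mulr_ge0// ltW.
Qed.

Definition box_of (k : 'I_d -> nat) (u : 'I_d -> nat -> 'I_b) : elem_index b k :=
  [ffun j => Ordinal (prefix_index_lt (u j) (k j))].

Lemma in_elem_boxP p (k : 'I_d -> nat) (u : 'I_d -> nat -> 'I_b) :
  wf_bpoint p ->
  reflect (forall j i, (i < k j)%N -> digits hb p j i = u j i)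
          (in_elem p (box_of k u)).
Proof.
move=> hp; rewrite in_elemE//; apply: (iffP forallP) => H j.
  by apply/prefix_index_inj; have /eqP := H j; rewrite ffunE.
by rewrite ffunE /=; apply/eqP/prefix_index_inj/H.
Qed.

End Boxes.

(** * Cylinder events of the random permutations *)

Section PermutationCount.
Variable b : nat.

(** Composition with a transposition shows that all values at [a] are taken
    equally often. *)
Lemma card_perm_at (a e : 'I_b) :
  (#|[set s : {perm 'I_b} | s a == e]%SET| * b = b`!)%N.
Proof.
have eqc e' : #|[set s : {perm 'I_b} | s a == e']%SET|
            = #|[set s : {perm 'I_b} | s a == e]%SET|.
  rewrite -[RHS](card_imset _ (@mulIg _ (tperm e e'))); apply: eq_card => s.
  rewrite inE; apply/eqP/imsetP => [sa|[s' /[!inE] /eqP sa ->]].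
    exists (s * tperm e e')%g; last by rewrite -mulgA tperm2 mulg1.
    by rewrite inE permM sa tpermR.
  by rewrite permM sa tpermL.
transitivity (\sum_(e' : 'I_b) #|[set s : {perm 'I_b} | s a == e']%SET|)%N.
  by rewrite (eq_bigr _ (fun e' _ => eqc e')) sum_nat_const card_ord mulnC.
rewrite -card_Sn -sum1_card.
rewrite (partition_big (fun s : {perm 'I_b} => s a) xpredT)//=.
apply: eq_bigr => e' _; rewrite -sum1_card; apply: eq_bigl => s.
by rewrite !inE.
Qed.

(** Positivity gives the lower bound [1 / b!] for the frequency, and constant
    factors disappear on the logarithmic scale. *)
Lemma card_perm_at2 (a a' e e' : 'I_b) : a != a' -> e != e' ->
  (0 < #|[set s : {perm 'I_b} | (s a == e) && (s a' == e')]%SET|)%N.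
Proof.
move=> aa' ee'; apply/card_gt0P; exists (tperm a e * tperm (tperm a e a') e')%g.
rewrite inE !permM tpermL tpermL eqxx andbT.
have D : tperm a e a' != e.
  by apply: contraNneq aa' => H; apply/eqP/(@perm_inj _ (tperm a e)); rewrite H tpermL.
by apply/eqP/tpermD => //; rewrite eq_sym.
Qed.

End PermutationCount.

Section FiniteValued.
Variables (disp : measure_display) (Omega : measurableType disp) (R : realType).
Variables (Pr : probability Omega R) (T : finType) (f : Omega -> T).
Hypothesis mf : forall t, measurable [set w | f w = t].

Let bigcup_fibres (B : {set T}) :
  [set w | f w \in B] = \bigcup_(t in [set` B]) [set w | f w = t].
Proof.
by apply/seteqP; split=> w /= => [H|[s sB E]]; [exists (f w)|rewrite E].
Qed.

Lemma measurable_finite_valued (B : {set T}) : measurable [set w | f w \in B].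
Proof.
rewrite bigcup_fibres.
by apply: fin_bigcup_measurable => [|s _ //]; apply: finite_finpred.
Qed.

Lemma prob_finite_valued (B : {set T}) :
  Pr [set w | f w \in B] = (\sum_(t in B) Pr [set w | f w = t])%E.
Proof.
have fin : finite_set [set` B] by exact: finite_finpred.
have triv : trivIset [set` B] (fun t => [set w | f w = t]).
  by move=> s s' _ _ [w /= [<- <-]].
rewrite bigcup_fibres (measure_fin_bigcup _ fin triv)//.
rewrite -(@bigfs _ _ _ _ (enum B) (mem B)) ?enum_uniq//; last first.
  by move=> s /= sB /negP[]; rewrite mem_enum.
by rewrite big_enum_cond /=; apply: eq_bigl => t; rewrite andbb.
Qed.

End FiniteValued.

Section Cylinders.
Variables (disp : measure_display) (Omega : measurableType disp) (R : realType).
Variables (Pr : probability Omega R) (b d : nat).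
Variable pi : 'I_d -> seq 'I_b -> Omega -> {perm 'I_b}.
Hypothesis hpi : owen_family Pr pi.

(** A site of the digit tree together with the permutations allowed there.
    Lists of constraints turn intersections of events into concatenations. *)
Definition constraint := (('I_d * seq 'I_b) * {set {perm 'I_b}})%type.

Definition cylinder (C : seq constraint) : set Omega :=
  [set w | forall c, c \in C -> pi c.1.1 c.1.2 w \in c.2].

Definition weight (C : seq constraint) : R :=
  \prod_(c <- C) (#|c.2|%:R / b`!%:R).

Lemma weight_cat C C' : weight (C ++ C') = weight C * weight C'.
Proof. by rewrite /weight big_cat. Qed.

Lemma weight_ge0 C : 0 <= weight C.
Proof. by apply: prodr_ge0 => c _; rewrite divr_ge0. Qed.

Lemma cylinder_cat C C' : cylinder (C ++ C') = cylinder C `&` cylinder C'.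
Proof.
apply/seteqP; split=> w /=.
  by move=> H; split=> c cC; apply: H; rewrite mem_cat cC ?orbT.
by move=> [H H'] c; rewrite mem_cat => /orP[]; [apply: H|apply: H'].
Qed.

Lemma measurable_permutation j u (B : {set {perm 'I_b}}) :
  measurable [set w | pi j u w \in B].
Proof. by have [mpi _ _] := hpi; apply/measurable_finite_valued/mpi. Qed.

Lemma measurable_cylinder C : measurable (cylinder C).
Proof.
elim: C => [|c C IH].
  by rewrite (_ : cylinder _ = setT) //; apply/seteqP; split.
rewrite -cat1s cylinder_cat; apply: measurableI => //.
rewrite (_ : cylinder _ = [set w | pi c.1.1 c.1.2 w \in c.2]).
  exact: measurable_permutation.
apply/seteqP; split=> w /= => [|H c' /[!inE] /eqP -> //].
by apply; rewrite inE.
Qed.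

Lemma permutation_prob j u (B : {set {perm 'I_b}}) :
  Pr [set w | pi j u w \in B] = (#|B|%:R / b`!%:R)%:E.
Proof.
have [mpi ppi _] := hpi; rewrite (prob_finite_valued _ (mpi j u)).
rewrite (eq_bigr (fun=> (b`!%:R^-1)%:E)); last by move=> s _; exact: ppi.
by rewrite sumEFin sumr_const mulr_natl.
Qed.

(** This is the independence of the permutations: the sets attached to the sites
    are read off the list, unambiguously since each site occurs once. *)
Lemma cylinder_prob C : uniq [seq c.1 | c <- C] ->
  Pr (cylinder C) = (weight C)%:E.
Proof.
move=> uC; have [_ _ indep] := hpi.
pose B i := (nth (i, [set: {perm 'I_b}]%SET) C (index i [seq c.1 | c <- C])).2.
have BE c : c \in C -> B c.1 = c.2.
  move=> cC; have kC : (index c C < size C)%N by rewrite index_mem.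
  rewrite /B -[in index _](nth_index c cC) -(nth_map c c.1)//.
  by rewrite index_uniq ?size_map// (set_nth_default c)// nth_index.
have -> : cylinder C =
    [set w | forall i, i \in [seq c.1 | c <- C] -> pi i.1 i.2 w \in B i].
  apply/seteqP; split=> w /= H.
    by move=> i /mapP[c cC ->]; rewrite BE//; apply: H.
  by move=> c cC; rewrite -BE//; apply/H/map_f.
rewrite indep// big_map -prodEFin !big_seq.
by apply: eq_bigr => c cC; rewrite BE// permutation_prob.
Qed.

End Cylinders.

(** * A second moment bound *)

Section SecondMoment.
Variables (disp : measure_display) (Omega : measurableType disp) (R : realType).
Variables (Pr : probability Omega R) (I : finType) (F : I -> set Omega).
Hypothesis mF : forall i, measurable (F i).

Let occ (w : Omega) : {set I} := [set i | `[< F i w >]]%SET.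

Let occP i w : reflect (F i w) (i \in occ w).
Proof. by rewrite inE; apply: asboolP. Qed.

Let measurable_occ (S : {set I}) : measurable [set w | occ w = S].
Proof.
rewrite (_ : [set _ | _] =
  \bigcap_(i in [set: I]) (if i \in S then F i else ~` F i)); last first.
  apply/seteqP; split=> w /= => [<- i _|H].
    by case: occP.
  by apply/setP => i; have := H i Logic.I; case: ifP => _ /occP // /negbTE.
apply: fin_bigcap_measurable => [|i _].
  exact: finite_finset.
by case: ifP => _ //; apply: measurableC.
Qed.

Let p (S : {set I}) : R := fine (Pr [set w | occ w = S]).

Let pE (B : {set {set I}}) :
  fine (Pr [set w | occ w \in B]) = \sum_(S in B) p S.
Proof.
rewrite prob_finite_valued//.
rewrite (eq_bigr (fun S => (p S)%:E)) ?sumEFin// => S _.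
by rewrite /p fineK// fin_num_measure.
Qed.

Let p_total : \sum_S p S = 1.
Proof.
have := pE [set: {set I}]%SET; rewrite (_ : [set _ | _] = setT).
  rewrite probability_setT /= => ->.
  by apply: eq_bigl => S; rewrite inE.
by apply/seteqP; split=> // w _ /=; rewrite inE.
Qed.

Let pF i : fine (Pr (F i)) = \sum_S p S * (i \in S)%:R.
Proof.
have := pE [set S : {set I} | i \in S]%SET; rewrite (_ : [set _ | _] = F i).
  move=> ->; rewrite big_mkcond; apply: eq_bigr => S _.
  by rewrite inE; case: ifP; rewrite ?mulr1 ?mulr0.
by apply/seteqP; split=> w /=; rewrite inE => /occP.
Qed.

Let pFF i j : fine (Pr (F i `&` F j)) =
  \sum_S p S * ((i \in S)%:R * (j \in S)%:R).
Proof.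
have := pE [set S : {set I} | (i \in S) && (j \in S)]%SET.
rewrite (_ : [set _ | _] = F i `&` F j).
  move=> ->; rewrite big_mkcond; apply: eq_bigr => S _.
  by rewrite inE; case: (i \in S); case: (j \in S); rewrite /= ?mulr1 ?mulr0.
apply/seteqP; split=> w /=; rewrite inE; first by move=> /andP[/occP ? /occP].
by move=> [/occP -> /occP ->].
Qed.

(** Chebyshev's inequality for the number of occurring events, at the value 0 of
    that number. The set of occurring events takes finitely many values, so
    that all moments are finite sums over its distribution. *)
Lemma second_moment :
  (\sum_i fine (Pr (F i))) ^+ 2 * fine (Pr [set w | forall i, ~ F i w])
    <= \sum_i \sum_j fine (Pr (F i `&` F j)) - (\sum_i fine (Pr (F i))) ^+ 2.
Proof.
set s1 := \sum_i fine (Pr (F i)); pose n (S : {set I}) : R := #|S|%:R.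
have nE S : n S = \sum_i (i \in S)%:R.
  by rewrite /n -sum1_card natr_sum big_mkcond; apply: eq_bigr => i _; case: ifP.
have s1E : s1 = \sum_S p S * n S.
  rewrite /s1; under eq_bigr do rewrite pF.
  by rewrite exchange_big; apply: eq_bigr => S _; rewrite nE mulr_sumr.
have s2E : \sum_i \sum_j fine (Pr (F i `&` F j)) = \sum_S p S * n S ^+ 2.
  under eq_bigr do under eq_bigr do rewrite pFF.
  under eq_bigr do rewrite exchange_big /=.
  rewrite exchange_big /=; apply: eq_bigr => S _.
  under eq_bigr do rewrite -mulr_sumr -mulr_sumr -nE.
  by rewrite -mulr_sumr -mulr_suml -nE expr2.
have -> : \sum_i \sum_j fine (Pr (F i `&` F j)) - s1 ^+ 2
    = \sum_S p S * (n S - s1) ^+ 2.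
  under [RHS]eq_bigr do rewrite sqrrB mulrDr mulrBr.
  rewrite big_split sumrB /= -s2E -mulr_suml p_total mul1r.
  have -> : \sum_S p S * ((n S * s1) *+ 2) = (s1 * s1) *+ 2.
    rewrite {2}s1E mulr_suml -sumrMnl; apply: eq_bigr => S _.
    by rewrite mulrnAr mulrA.
  by rewrite expr2; lra.
have p0 S : 0 <= p S by rewrite fine_ge0.
rewrite (bigD1 finset.set0) //= /n cards0 sub0r sqrrN mulrC.
rewrite (_ : [set _ | _] = [set w | occ w = finset.set0]).
  by rewrite lerDl sumr_ge0// => S _; rewrite mulr_ge0// sqr_ge0.
apply/seteqP; split=> w /= H; last first.
  by move=> i /occP; rewrite H inE.
by apply/setP => i; rewrite [RHS]inE; apply/occP/H.
Qed.

End SecondMoment.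

(** * Scrambling a pair of digit streams *)

Section Scrambling.
Variables (b : nat) (hb : (1 < b)%N).
Implicit Types (p : seq 'I_b -> {perm 'I_b}) (u v : nat -> 'I_b).

Definition scrambled p u : nat -> 'I_b := fun r => p (mkseq u r) (u r).

Lemma scrambled_eq p u v c : (forall i, (i < c)%N -> u i = v i) ->
  forall i, (i < c)%N -> scrambled p u i = scrambled p v i.
Proof.
move=> uv i ic; rewrite /scrambled uv//; congr (p _ _).
by apply/eq_mkseq_prefix => h hi; apply/uv/ltn_trans/ic.
Qed.

Lemma scrambled_neq p u v c : (forall i, (i < c)%N -> u i = v i) ->
  u c != v c -> scrambled p u c != scrambled p v c.
Proof.
move=> uv; rewrite /scrambled.
by have /eq_mkseq_prefix -> := uv; rewrite (inj_eq perm_inj).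
Qed.

(** Scrambling acts bijectively on prefixes; the digits of a preimage are found
    one after the other. *)
Lemma scrambled_surj p (tau : nat -> 'I_b) (k : nat) :
  exists u, forall i, (i < k)%N -> scrambled p u i = tau i.
Proof.
elim: k => [|k [u IH]]; first by exists tau.
pose u' i := if i == k then (p (mkseq u k))^-1%g (tau k) else u i.
have uu' i : (i < k)%N -> u' i = u i by move=> ik; rewrite /u' ltn_eqF.
exists u' => i; rewrite ltnS leq_eqVlt => /orP[/eqP->|ik].
  rewrite /scrambled; have /eq_mkseq_prefix -> := uu'.
  by rewrite /u' eqxx permKV.
by rewrite (scrambled_eq p uu')// IH.
Qed.

Definition bottom_digit : 'I_b := Ordinal (ltnW hb).

Fact pred_base_lt : (b.-1 < b)%N.
Proof. by rewrite ltn_predL ltnW. Qed.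

Definition top_digit : 'I_b := Ordinal pred_base_lt.

Lemma ordS_neq (e : 'I_b) : e != ordS e.
Proof.
apply/eqP => /(congr1 val) /=; have := ltn_ord e.
rewrite leq_eqVlt => /orP[/eqP E|le]; last by rewrite modn_small//; lia.
by rewrite E modnn; lia.
Qed.

(** For [e] below the top digit and [c] the common prefix length, this means that
    [v] is one unit above [u] in the last of the first [r] places. At the top
    digit [ordS] wraps around; that value of [e] only enlarges a union bound. *)
Definition straddles (e : 'I_b) u v c r :=
  [/\ u c = e, v c = ordS e &
      forall i, (c < i < r)%N -> u i = top_digit /\ v i = bottom_digit].

Lemma straddle_of_close (R : realType) u v c r :
  (forall i, (i < c)%N -> u i = v i) -> u c != v c -> (c < r)%N ->
  `|digits_value R u - digits_value R v| < (b%:R ^+ r)^-1 ->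
  exists e, straddles e u v c r \/ straddles e v u c r.
Proof.
move=> uv uvc cr H.
wlog lt : u v uv {uvc} H / (u c < v c)%N.
  move=> W; move: uvc; rewrite -val_eqE /= neq_ltn => /orP[lt|lt].
    exact: W.
  have [||e] := W v u _ _ lt.
  - by move=> i ic; rewrite uv.
  - by rewrite distrC.
  by exists e; tauto.
have [E K] := straddle_of_adjacent uv lt cr (close_prefix_index hb H).
exists (u c); left; split=> //.
  by apply: val_inj; rewrite /= modn_small -E.
by move=> i /K[ui vi]; split; apply: val_inj.
Qed.

Lemma close_of_straddle (R : realType) (e : 'I_b) u v c r :
  (forall i, (i < c)%N -> u i = v i) -> (e.+1 < b)%N ->
  ((c < r)%N -> straddles e u v c r) ->
  `|digits_value R u - digits_value R v| <= 2 / b%:R ^+ r.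
Proof.
move=> uv eb H; apply: digits_value_close => //.
have [cr|rc] := ltnP c r; last first.
  by left; apply/prefix_index_inj => i ir; apply/uv/leq_trans/rc.
right; have [uc vc K] := H cr; apply: (adjacent_of_straddle uv) => //.
  by rewrite vc uc /= modn_small.
by move=> i /K[-> ->].
Qed.

End Scrambling.

Section StraddleConstraints.
Variables (b d : nat) (hb : (1 < b)%N).
Implicit Types (u v : nat -> 'I_b) (j : 'I_d).

Let fix_digits j u (e : 'I_b) (s : seq nat) : seq (constraint b d) :=
  [seq ((j, mkseq u i), [set p : {perm 'I_b} | p (u i) == e]%SET) | i <- s].

(** After their first difference the two streams visit different nodes of the
    digit tree, so these sites are pairwise distinct. *)
Definition straddle_constraints j u v r (e e' : 'I_b) : seq (constraint b d) :=
  let c := common_prefix u v r in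
  if (c < r)%N then
    ((j, mkseq u c),
      [set p : {perm 'I_b} | (p (u c) == e) && (p (v c) == e')]%SET)
    :: fix_digits j u (top_digit hb) (iota c.+1 (r - c.+1))
       ++ fix_digits j v (bottom_digit hb) (iota c.+1 (r - c.+1))
  else [::].

Lemma cylinder_straddle (disp : measure_display) (Omega : measurableType disp)
    (pi : 'I_d -> seq 'I_b -> Omega -> {perm 'I_b}) j u v r e w :
  let c := common_prefix u v r in
  cylinder pi (straddle_constraints j u v r e (ordS e)) w <->
  ((c < r)%N -> straddles hb e (scrambled (fun s => pi j s w) u)
                              (scrambled (fun s => pi j s w) v) c r).
Proof.
move=> c; rewrite /straddle_constraints -/c; case: ifP => cr; last first.
  by split=> // _ x; rewrite in_nil.
have uvc : mkseq v c = mkseq u c.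
  by apply/eq_mkseq_prefix => i ic; rewrite (common_prefix_eq ic).
have ir i : (i \in iota c.+1 (r - c.+1)) = (c < i < r)%N.
  by rewrite mem_iota subnKC.
rewrite /straddles /scrambled uvc; split=> [H _|/(_ isT)[H1 H2 H3] x].
  have /[!inE] /andP[/eqP H1 /eqP H2] := H _ (mem_head _ _).
  split=> // i; rewrite -ir => ii; split.
    by have := H ((j, mkseq u i), [set p : {perm 'I_b} | p (u i) == top_digit hb]%SET);
      rewrite in_cons mem_cat map_f ?orbT// => /(_ isT) /= /[!inE] /eqP.
  by have := H ((j, mkseq v i), [set p : {perm 'I_b} | p (v i) == bottom_digit hb]%SET);
    rewrite in_cons mem_cat [X in _ || (_ || X)]map_f ?orbT// => /(_ isT) /= /[!inE] /eqP.
rewrite in_cons mem_cat => /or3P[/eqP->|/mapP[i + ->]|/mapP[i + ->]] /=.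
- by rewrite inE H1 H2 !eqxx.
- by rewrite ir inE => /H3[-> _].
- by rewrite ir inE => /H3[_ ->].
Qed.

Lemma uniq_straddle j u v r e e' :
  uniq [seq x.1 | x <- straddle_constraints j u v r e e'].
Proof.
rewrite /straddle_constraints; set c := common_prefix u v r.
case: ifP => // cr.
have uvc : u c != v c by apply: common_prefix_neq.
have uniq_fix y e1 : uniq [seq x.1 | x <- fix_digits j y e1 (iota c.+1 (r - c.+1))].
  rewrite -map_comp map_inj_uniq ?iota_uniq// => i i' /= [] /(congr1 size).
  by rewrite !size_mkseq.
have fresh y e1 : (j, mkseq u c) \notin [seq x.1 | x <- fix_digits j y e1 (iota c.+1 (r - c.+1))].
  apply/negP; rewrite -map_comp => /mapP[i]; rewrite mem_iota => /andP[ci _] /= [].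
  by move=> /(congr1 size); rewrite !size_mkseq; lia.
rewrite /= map_cat mem_cat negb_or !fresh cat_uniq !uniq_fix /= andbT.
apply/hasPn => x; rewrite -map_comp => /mapP[i]; rewrite mem_iota => /andP[ci _] /= ->.
apply/negP; rewrite -map_comp => /mapP[i' _] /= [] E.
have ii : i = i' by move: (congr1 size E); rewrite !size_mkseq.
move: E; rewrite -ii => /eq_mkseq_prefix /(_ _ ci) E.
by move: uvc; rewrite E eqxx.
Qed.

(** All sites extend the common prefix: pairs of points lying in boxes with
    different prefixes in some coordinate use disjoint sites there. *)
Lemma straddle_sites_prefix j u v r e e' x k : (k <= common_prefix u v r)%N ->
  x \in straddle_constraints j u v r e e' ->
  [/\ x.1.1 = j, (k <= size x.1.2)%N & take k x.1.2 = mkseq u k].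
Proof.
rewrite /straddle_constraints; set c := common_prefix u v r => kc.
have takeE i y : (k <= i)%N -> take k (mkseq y i) = mkseq y k.
  by move=> ki; rewrite /mkseq -map_take take_iota (minn_idPl ki).
have uvk : mkseq v k = mkseq u k.
  by apply/eq_mkseq_prefix => i ik; rewrite (common_prefix_eq (leq_trans ik kc)).
case: ifP => // cr; rewrite in_cons mem_cat => /or3P[/eqP->|/mapP[i + ->]|/mapP[i + ->]] /=.
- by rewrite size_mkseq takeE.
- rewrite mem_iota => /andP[ci _]; have ki : (k <= i)%N by lia.
  by rewrite size_mkseq takeE.
- rewrite mem_iota => /andP[ci _]; have ki : (k <= i)%N by lia.
  by rewrite size_mkseq takeE// uvk.
Qed.

Section Weight.
Variable R : realType.

Let b0 : 0 < b%:R :> R. Proof. by rewrite ltr0n; lia. Qed.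

Let weight_fix j y e1 s : weight R (fix_digits j y e1 s) = (b%:R ^+ size s)^-1.
Proof.
elim: s => [|i s IH]; first by rewrite /weight big_nil expr0 invr1.
rewrite /weight /= big_cons -/(weight R _) IH exprS invfM; congr *%R.
have f0 : b`!%:R != 0 :> R by rewrite pnatr_eq0 -lt0n fact_gt0.
rewrite -(card_perm_at (y i) e1) /= natrM.
rewrite -(card_perm_at (y i) e1) natrM mulf_eq0 negb_or in f0.
by case/andP: f0 => f0 _; rewrite invfM mulrA divff ?mul1r.
Qed.

(** The site at the first difference has a weight between [1 / b!] and [1], and
    each of the [2 * (r - c.+1)] sites after it has weight [1 / b]. *)
Lemma weight_straddle j u v r e e' (c := common_prefix u v r) : e != e' ->
  (b`!%:R)^-1 * b%:R ^+ (2 * c) / b%:R ^+ (2 * r)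
    <= weight R (straddle_constraints j u v r e e')
    <= b%:R ^+ (2 * c.+1) / b%:R ^+ (2 * r).
Proof.
move=> ee'; rewrite /straddle_constraints -/c.
have p0 n : 0 < b%:R ^+ n :> R by rewrite exprn_gt0.
have pw n : 0 <= b%:R ^+ n :> R := ltW (p0 n).
have b1 : 1 <= b%:R :> R by rewrite ler1n ltnW.
have f0 : 0 < b`!%:R :> R by rewrite ltr0n fact_gt0.
have f1 : b`!%:R^-1 <= 1 :> R by rewrite invf_le1// ler1n fact_gt0.
rewrite ler_pdivlMr// ler_pdivrMr//; case: ifP => cr; last first.
  have -> : c = r by have := common_prefix_le u v r; rewrite -/c; lia.
  rewrite /weight big_nil mul1r ler_piMl//=.
  by rewrite ler_weXn2l//; lia.
set q := [set p : {perm 'I_b} | _]%SET.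
have q0 : (b`!%:R^-1 : R) <= (#|q|%:R / b`!%:R : R) <= 1.
  apply/andP; split; last first.
    by rewrite ler_pdivrMr// mul1r ler_nat -card_Sn max_card.
  apply: ler_peMl; first by rewrite invr_ge0 ltW.
  by rewrite ler1n card_perm_at2// common_prefix_neq.
have -> : weight R (((j, mkseq u c), q)
    :: fix_digits j u (top_digit hb) (iota c.+1 (r - c.+1))
       ++ fix_digits j v (bottom_digit hb) (iota c.+1 (r - c.+1))) * b%:R ^+ (2 * r)
  = #|q|%:R / b`!%:R * b%:R ^+ (2 * c.+1).
  rewrite -cat1s !weight_cat !weight_fix !size_iota {1}/weight big_seq1 /=.
  have -> : (2 * r = (r - c.+1) + (r - c.+1) + 2 * c.+1)%N by lia.
  rewrite !exprD -!mulrA; congr (_ * (_ * _)).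
  by rewrite !mulKf ?gt_eqF.
case/andP: q0 => q0 q1; rewrite [X in _ && X]ler_piMl// andbT.
by apply: ler_pM => //; rewrite ler_weXn2l//; lia.
Qed.

End Weight.
End StraddleConstraints.

(** * Coincidences and pairs of points *)

Section SupNorm.
Variables (R : realType) (d : nat).
Implicit Types x y : 'rV[R]_d.

Lemma row_norm_le x (e : R) : 0 <= e -> (forall j, `|x 0 j| <= e) -> `|x| <= e.
Proof.
move=> e0 H; rewrite [leLHS]/Num.Def.normr/= mx_normrE.
by apply: (bigmax_le _ e0) => -[i j] _ /=; rewrite ord1.
Qed.

Lemma entry_le_norm x j : `|x 0 j| <= `|x|.
Proof.
rewrite [leRHS]/Num.Def.normr/= mx_normrE.
by apply/bigmax_geP; right => /=; exists (0, j).
Qed.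

End SupNorm.

Section Coincidences.
Variables (R : realType) (b d N : nat).
Hypothesis hb : (1 < b)%N.
Variable P : 'I_N -> bpoint R b d.
Hypothesis wfP : forall n, wf_bpoint (P n).

Definition point_box (k : 'I_d -> nat) (n : 'I_N) : elem_index b k :=
  box_of k (digits hb (P n)).

Lemma in_elem_point_box k n a : in_elem (P n) a = (point_box k n == a).
Proof.
rewrite (in_elemE hb)//; apply/forallP/eqP => [H|<- j]; last by rewrite ffunE.
by apply/ffunP => j; apply: val_inj; rewrite ffunE /=; apply/eqP.
Qed.

Lemma eq_point_box k n n' :
  (forall j i, (i < k j)%N -> digits hb (P n) j i = digits hb (P n') j i) ->
  point_box k n = point_box k n'.
Proof.
move=> H; apply/ffunP => j; apply: val_inj; rewrite !ffunE /=.
exact/prefix_index_inj/H.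
Qed.

(** Coincidences are the ordered pairs of distinct indices in a common box. *)
Lemma coincidencesE k : coincidences P k =
  (\sum_n \sum_(n' | n' != n) (point_box k n' == point_box k n))%N.
Proof.
have countE a : elem_count P a = #|[set n | point_box k n == a]%SET|.
  by apply: eq_card => n; rewrite !inE in_elem_point_box.
rewrite /coincidences (partition_big (point_box k) xpredT)//=.
apply: eq_bigr => a _; rewrite countE -sum_nat_const.
rewrite [LHS](eq_bigl (fun n => point_box k n == a)); last by move=> n; rewrite inE.
apply: eq_bigr => n /eqP na; rewrite -big_mkcondr /= sum1_card.
rewrite (cardsD1 n) inE na eqxx add1n subn1 /=; apply: eq_card => n'.
by rewrite !inE.
Qed.

End Coincidences.

Section PairConstraints.
Variables (b d : nat) (hb : (1 < b)%N).
Implicit Types (U V : 'I_d -> nat -> 'I_b) (e : 'I_d -> 'I_b).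

(** The list of coordinates is a parameter because the second moment bound gives
    up the coordinates in which two boxes share their prefix. *)
Definition pair_constraints U V r e (js : seq 'I_d) : seq (constraint b d) :=
  flatten [seq straddle_constraints hb j (U j) (V j) r (e j) (ordS (e j))
          | j <- js].

Lemma mem_pair_constraints U V r e js x : x \in pair_constraints U V r e js ->
  x.1.1 \in js /\
  x \in straddle_constraints hb x.1.1 (U x.1.1) (V x.1.1) r (e x.1.1)
          (ordS (e x.1.1)).
Proof.
move=> /flattenP[s /mapP[j jj ->] xs].
by have [E _ _] := straddle_sites_prefix (leq0n _) xs; rewrite E.
Qed.

Lemma uniq_pair_constraints U V r e js : uniq js ->
  uniq [seq x.1 | x <- pair_constraints U V r e js].
Proof.
elim: js => // j js IH /= /andP[jj ujs].
rewrite /pair_constraints /= map_cat cat_uniq uniq_straddle IH// andbT /=.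
apply/hasPn => _ /mapP[x xs ->]; apply/negP => /mapP[y ys E].
have [xjs _] := mem_pair_constraints xs.
have [yj _ _] := straddle_sites_prefix (leq0n _) ys.
by move: xjs; rewrite E yj (negbTE jj).
Qed.

Lemma weight_pair_constraints (R : realType) U V r e js :
  weight R (pair_constraints U V r e js) =
  \prod_(j <- js) weight R (straddle_constraints hb j (U j) (V j) r (e j) (ordS (e j))).
Proof.
elim: js => [|j js IH]; first by rewrite /weight !big_nil.
by rewrite /pair_constraints /= weight_cat IH big_cons.
Qed.

Lemma cylinder_pair (disp : measure_display) (Omega : measurableType disp)
    (pi : 'I_d -> seq 'I_b -> Omega -> {perm 'I_b}) U V r e js w :
  cylinder pi (pair_constraints U V r e js) w <->
  forall j, j \in js ->
    cylinder pi (straddle_constraints hb j (U j) (V j) r (e j) (ordS (e j))) w.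
Proof.
split=> [H j jj x xs|H x /flattenP[s /mapP[j jj ->] xs]].
  by apply: H; apply/flattenP; eexists; first apply/map_f/jj.
exact: H xs.
Qed.

Lemma weight_pair_le (R : realType) U V r e :
  weight R (pair_constraints U V r e (enum 'I_d)) <=
  b%:R ^+ (2 * d) / b%:R ^+ (2 * r * d)
    * b%:R ^+ (2 * \sum_j common_prefix (U j) (V j) r).
Proof.
have b0 : 0 < b%:R :> R by rewrite ltr0n; lia.
rewrite weight_pair_constraints big_enum (eq_bigl xpredT)//=.
have -> : b%:R ^+ (2 * d) / b%:R ^+ (2 * r * d)
    * b%:R ^+ (2 * \sum_j common_prefix (U j) (V j) r)
  = \prod_(j < d) (b%:R ^+ (2 * (common_prefix (U j) (V j) r).+1)
       / b%:R ^+ (2 * r)) :> R.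
  rewrite prodf_div prodr_const card_ord -exprM -expr_sum mulrAC -exprD.
  congr (_ ^+ _ / _); rewrite -big_distrr -mulnDr; congr (_ * _)%N.
  rewrite -[X in (X + _)%N]card_ord -sum1_card -big_split.
  by apply: eq_bigr.
apply: ler_prod => j _; rewrite weight_ge0 /=.
by have /andP[] := weight_straddle hb R j (U j) (V j) r (ordS_neq hb (e j)).
Qed.

End PairConstraints.

(** * No pair is too close *)

Section UnionBound.
Variables (disp : measure_display) (Omega : measurableType disp) (R : realType).
Variable Pr : probability Omega R.

Lemma fine_prob_le (A B : set Omega) : measurable A -> measurable B ->
  A `<=` B -> fine (Pr A) <= fine (Pr B).
Proof.
move=> mA mB AB; apply: fine_le; rewrite ?fin_num_measure//.
by apply: le_measure; rewrite ?inE.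
Qed.

Lemma fine_probU (A B : set Omega) : measurable A -> measurable B ->
  fine (Pr (A `|` B)) <= fine (Pr A) + fine (Pr B).
Proof.
move=> mA mB; rewrite -fineD ?fin_num_measure//.
apply: fine_le; rewrite ?fin_numD ?fin_num_measure//; first exact: measurableU.
exact: measureU2.
Qed.

Variables (T : finType) (Q : pred T) (F : T -> set Omega).
Hypothesis mF : forall t, measurable (F t).

Lemma measurable_exists : measurable [set w | exists2 t, Q t & F t w].
Proof.
rewrite (_ : [set _ | _] = \bigcup_(t in [set` Q]) F t).
  by apply: fin_bigcup_measurable => [|t _ //]; apply: finite_finpred.
by apply/seteqP; split=> w /= [t Qt Ft]; exists t.
Qed.

Lemma prob_exists_le (g : T -> R) : (forall t, Q t -> fine (Pr (F t)) <= g t) ->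
  fine (Pr [set w | exists2 t, Q t & F t w]) <= \sum_(t | Q t) g t.
Proof.
move=> Fg; apply: (@le_trans _ _ (\sum_(t | Q t) fine (Pr (F t)))); last first.
  exact: ler_sum.
rewrite -big_filter; set s := [seq _ <- _ | _].
have -> : [set w | exists2 t, Q t & F t w] = [set w | exists2 t, t \in s & F t w].
  apply/seteqP; split=> w /= [t Qt Ft]; exists t => //.
    by rewrite mem_filter Qt mem_index_enum.
  by move: Qt; rewrite mem_filter => /andP[].
have ms (s' : seq T) : measurable [set w | exists2 t, t \in s' & F t w].
  rewrite (_ : [set _ | _] = \bigcup_(t in [set` s']) F t).
    by apply: fin_bigcup_measurable => [|t _ //]; apply: finite_finpred.
  by apply/seteqP; split=> w /= [t Qt Ft]; exists t.
elim: s => [|t s IH].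
  rewrite big_nil (_ : [set _ | _] = set0) ?measure0//.
  by apply/seteqP; split=> w //= [].
rewrite big_cons; apply: (le_trans _ (lerD (lexx _) IH)).
apply: (le_trans _ (fine_probU (mF t) (ms s))).
apply: fine_prob_le; [exact: ms|exact: measurableU|].
move=> w [t' /[!inE] /orP[/eqP->|ts] Ft]; [by left|by right; exists t'].
Qed.

End UnionBound.

Section ClosePairs.
Variables (disp : measure_display) (Omega : measurableType disp) (R : realType).
Variables (Pr : probability Omega R) (b d : nat) (hb : (1 < b)%N).
Variable pi : 'I_d -> seq 'I_b -> Omega -> {perm 'I_b}.
Hypothesis hpi : owen_family Pr pi.
Variable x : nat -> bpoint R b d.

Definition scrambled_point (w : Omega) (n : nat) : 'rV[R]_d :=
  scramble hb (fun j u => pi j u w) (x n).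

(** Either point can be the lower one, independently in each coordinate. *)
Definition swap_at (o : 'I_d -> bool) n n' (j : 'I_d) : nat -> 'I_b :=
  digits hb (x (if o j then n else n')) j.

Definition close_constraints n n' r (o : 'I_d -> bool) (e : 'I_d -> 'I_b) :=
  pair_constraints hb (swap_at o n n') (swap_at o n' n) r e (enum 'I_d).

(** A finite union of cylinders, hence measurable, that covers the event that
    two of the first [N] scrambled points are closer than [b ^ - r]. *)
Definition close_event (N r : nat) : set Omega :=
  [set w | exists2 t : ('I_N * 'I_N) * ({ffun 'I_d -> bool} * {ffun 'I_d -> 'I_b}),
     t.1.2 != t.1.1 &
     cylinder pi (close_constraints t.1.1 t.1.2 r t.2.1 t.2.2) w].

Lemma measurable_close_event N r : measurable (close_event N r).
Proof. by apply: measurable_exists => t; apply: measurable_cylinder hpi _. Qed.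

Lemma close_eventP N r w : ~ close_event N r w ->
  forall n n', (n < N)%N -> (n' < N)%N -> n != n' ->
  (b%:R ^+ r)^-1 <= `|scrambled_point w n - scrambled_point w n'|.
Proof.
move=> nc n n' nN n'N nn'; rewrite leNgt; apply/negP => lt; apply: nc.
pose c j := common_prefix (digits hb (x n) j) (digits hb (x n') j) r.
have close j : exists oe : bool * 'I_b, (c j < r)%N ->
    straddles hb oe.2
      (scrambled (fun s => pi j s w) (digits hb (x (if oe.1 then n else n')) j))
      (scrambled (fun s => pi j s w) (digits hb (x (if oe.1 then n' else n)) j))
      (c j) r.
  have [cr|rc] := ltnP (c j) r; last by exists (true, bottom_digit hb).
  have [|e [H|H]] := straddle_of_close hb (scrambled_eq _ (@common_prefix_eq _ _ _ r))
    (scrambled_neq (fun s => pi j s w) (@common_prefix_eq _ _ _ r)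
      (common_prefix_neq cr)) cr (R := R).
  - by apply: le_lt_trans lt; apply: le_trans (entry_le_norm _ j); rewrite !mxE.
  - by exists (true, e).
  - by exists (false, e).
have [oe Hoe] := choice close.
exists ((Ordinal nN, Ordinal n'N), ([ffun j => (oe j).1], [ffun j => (oe j).2])).
  by rewrite /= -val_eqE /= eq_sym.
apply/cylinder_pair => j _; apply/cylinder_straddle => /=.
rewrite /swap_at !ffunE; have := Hoe j; rewrite /c.
by case: (oe j).1; rewrite // common_prefixC.
Qed.

End ClosePairs.

Section ClosePairsProbability.
Variables (R : realType) (b d : nat) (hb : (1 < b)%N).
Variable x : nat -> bpoint R b d.
Hypothesis wfx : forall n, wf_bpoint (x n).
Variables (A : R) (m kappa : nat).
Hypothesis A0 : 0 <= A.
Hypothesis hcoinc : coincidence_bound A (@first_points (bpoint R b d) x (b ^ m)).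
Hypothesis hcut :
  @prefix_cutoff R b d m kappa (@first_points (bpoint R b d) x (b ^ m)).

Let N := (b ^ m)%N.
Let P : 'I_N -> bpoint R b d := @first_points (bpoint R b d) x N.

Let b0 : 0 < b%:R :> R. Proof. by rewrite ltr0n; lia. Qed.
Let p0 n : 0 < b%:R ^+ n :> R. Proof. by rewrite exprn_gt0. Qed.
Let pw n : 0 <= b%:R ^+ n :> R. Proof. exact: ltW. Qed.
Let b1 : 1 <= b%:R :> R. Proof. by rewrite ler1n ltnW. Qed.

Definition prefix_sum (r n n' : nat) : nat :=
  \sum_j common_prefix (digits hb (x n) j) (digits hb (x n') j) r.

(** The coincidence bound alone leaves a factor [b ^ level_sum k], which the
    cutoff keeps below [b ^ (m + kappa)]. *)
Lemma coincidences_weighted_le (k : 'I_d -> nat) :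
  b%:R ^+ (2 * level_sum k) * (coincidences P k)%:R
    <= A * b%:R ^+ kappa * b%:R ^+ (3 * m).
Proof.
have rhs0 : 0 <= A * b%:R ^+ kappa * b%:R ^+ (3 * m) by rewrite !mulr_ge0.
have [le|lt] := leqP (m + kappa) (level_sum k).
  rewrite (_ : coincidences P k = 0%N) ?mulr0//.
  apply: big1 => a _; have := hcut a le.
  by rewrite -/P; case: elem_count => [|[|c]].
have N0 : 0 <= N%:R :> R by rewrite ler0n.
apply: (@le_trans _ _ (b%:R ^+ (2 * level_sum k) *
    (A * N%:R * N%:R / b%:R ^+ level_sum k))).
  rewrite ler_wpM2l//; apply: le_trans (hcoinc k) _.
  rewrite ler_wpM2r ?invr_ge0// ler_wpM2l ?mulr_ge0//.
  by rewrite lerBlDr lerDl.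
rewrite mulrC mul2n -addnn exprD -!mulrA mulKf ?gt_eqF//.
rewrite ler_wpM2l// /N natrX -!exprD ler_weXn2l//; lia.
Qed.

(** A pair with common prefix lengths [k] is charged to level [k], where it is a
    coincidence. *)
Lemma prefix_sum_le r :
  \sum_(n < N) \sum_(n' < N | n' != n) b%:R ^+ (2 * prefix_sum r n n')
    <= r.+1%:R ^+ d * (A * b%:R ^+ kappa * b%:R ^+ (3 * m)) :> R.
Proof.
pose S (k : {ffun 'I_d -> 'I_r.+1}) := (fun j => k j : nat) : 'I_d -> nat.
pose same k (n n' : 'I_N) : R := (point_box hb P k n' == point_box hb P k n)%:R.
apply: (@le_trans _ _ (\sum_(n < N) \sum_(n' < N | n' != n)
    \sum_k b%:R ^+ (2 * level_sum (S k)) * same (S k) n n')).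
  apply: ler_sum => n _; apply: ler_sum => n' _.
  pose k0 : {ffun 'I_d -> 'I_r.+1} := [ffun j =>
    inord (common_prefix (digits hb (x n) j) (digits hb (x n') j) r)].
  have k0E j : k0 j = common_prefix (digits hb (x n) j) (digits hb (x n') j) r :> nat.
    by rewrite ffunE inordK// ltnS common_prefix_le.
  rewrite (bigD1 k0)//= [X in same X]/S /same.
  have -> : point_box hb P (S k0) n' = point_box hb P (S k0) n.
    apply: eq_point_box => j i; rewrite /S k0E => ic.
    by rewrite /P /first_points (common_prefix_eq ic).
  rewrite eqxx mulr1 /level_sum /prefix_sum.
  under [in leRHS]eq_bigr do rewrite /S k0E.
  by rewrite lerDl sumr_ge0// => k _; rewrite mulr_ge0.
rewrite (_ : \sum_(n < N) _ = \sum_k b%:R ^+ (2 * level_sum (S k)) *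
    (coincidences P (S k))%:R); last first.
  under eq_bigr do rewrite exchange_big /=.
  rewrite exchange_big /=; apply: eq_bigr => k _.
  rewrite (coincidencesE hb) ?natr_sum; last by move=> n; exact: wfx.
  rewrite mulr_sumr; apply: eq_bigr => n _.
  by rewrite natr_sum mulr_sumr.
apply: le_trans (ler_sum _ (fun k _ => coincidences_weighted_le (S k))) _.
by rewrite sumr_const card_ffun !card_ord -[r.+1%:R ^+ d]natrX mulr_natl.
Qed.

Variables (disp : measure_display) (Omega : measurableType disp).
Variable Pr : probability Omega R.
Variable pi : 'I_d -> seq 'I_b -> Omega -> {perm 'I_b}.
Hypothesis hpi : owen_family Pr pi.

(** Two factors [b ^ m] come from the choice of the pair and one from its
    deepest possible common prefix; [b ^ (2 * r * d)] outweighs their product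
    as soon as [r] exceeds [3 * m / (2 * d)] by a fixed proportion. *)
Lemma close_event_prob r : fine (Pr (close_event hb pi x N r)) <=
  ((2 * b) ^ d)%:R * b%:R ^+ (2 * d) * (A * b%:R ^+ kappa) *
    r.+1%:R ^+ d * b%:R ^+ (3 * m) / b%:R ^+ (2 * r * d).
Proof.
pose K : R := b%:R ^+ (2 * d) / b%:R ^+ (2 * r * d).
pose G (n n' : nat) : R := b%:R ^+ (2 * prefix_sum r n n').
pose OE := ({ffun 'I_d -> bool} * {ffun 'I_d -> 'I_b})%type.
apply: (@le_trans _ _ (\sum_(t : ('I_N * 'I_N) * OE | t.1.2 != t.1.1)
    K * G t.1.1 t.1.2)).
  apply: prob_exists_le => [t|t _].
    exact: measurable_cylinder hpi _.
  case: t => -[n n'] [sw e].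
  rewrite /= (cylinder_prob hpi) ?uniq_pair_constraints ?enum_uniq//=.
  apply: (le_trans (weight_pair_le hb R _ _ _ _)).
  rewrite (_ : (\sum_j _)%N = prefix_sum r n n')//.
  apply: eq_bigr => j _; rewrite /swap_at /=; case: (sw j) => //.
  exact: common_prefixC.
have -> : \sum_(t : ('I_N * 'I_N) * OE | t.1.2 != t.1.1) K * G t.1.1 t.1.2
  = ((2 * b) ^ d)%:R * (K * \sum_(n < N) \sum_(n' < N | n' != n) G n n').
  transitivity (\sum_(q : 'I_N * 'I_N | q.2 != q.1) \sum_(oe : OE) K * G q.1 q.2).
    rewrite pair_big /=; apply: eq_bigl => t; by rewrite andbT.
  rewrite [in RHS]pair_big_dep /= !mulr_sumr; apply: eq_bigr => q _.
  rewrite sumr_const card_prod !card_ffun !card_ord card_bool -expnMn.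
  by rewrite mulr_natl.
rewrite /K -!mulrA ler_wpM2l// ler_wpM2l//.
rewrite mulrC; set Y := b%:R ^+ (2 * r * d).
have -> : A * (b%:R ^+ kappa * (r.+1%:R ^+ d * (b%:R ^+ (3 * m) / Y)))
  = r.+1%:R ^+ d * (A * b%:R ^+ kappa * b%:R ^+ (3 * m)) / Y.
  by rewrite !mulrA; congr (_ * _ / _); rewrite mulrC !mulrA.
by rewrite ler_wpM2r ?invr_ge0 ?prefix_sum_le /Y.
Qed.

End ClosePairsProbability.

(** * Some pair is close *)

Section NetPoints.
Variables (R : realType) (b d t : nat) (hb : (1 < b)%N).
Variable x : nat -> bpoint R b d.
Hypothesis hx : td_sequence t x.

(** The index [i] of the block is free: for [t = 0] a net has a single point in
    each box, and a second one has to come from the next block. *)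
Lemma net_point (i k : nat) (u : 'I_d -> nat -> 'I_b) :
  exists n, (i * b ^ (d * k + t) <= n < i.+1 * b ^ (d * k + t))%N /\
    forall j h, (h < k)%N -> digits hb (x n) j h = u j h.
Proof.
have [wfx /(_ i (d * k + t)%N (leq_addl _ _)) [_ _ net]] := hx.
have := net (fun=> k) (box_of (fun=> k) u).
rewrite addnK /level_sum sum_nat_const card_ord => /(_ erefl) cnt.
have /card_gt0P[n] : (0 < #|[set n : 'I_(b ^ (d * k + t)) |
    in_elem (x (i * b ^ (d * k + t) + n)) (box_of (fun=> k) u)]%SET|)%N.
  by rewrite [X in (_ < X)%N]cnt expn_gt0 (ltnW hb).
rewrite inE => /(in_elem_boxP hb _ _ (wfx _)) H.
exists (i * b ^ (d * k + t) + n)%N; split; last exact: H.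
by rewrite leq_addr mulSn addnC ltn_add2r ltn_ord.
Qed.

Variable kappa : nat.
Hypothesis hcut : forall m : nat,
  @prefix_cutoff R b d m kappa (@first_points (bpoint R b d) x (b ^ m)).

(** Otherwise the two points would share a box in which the cutoff allows only
    one point. *)
Lemma prefix_sum_lt m r n n' : (n < b ^ m)%N -> (n' < b ^ m)%N -> n != n' ->
  (prefix_sum hb x r n n' < m + kappa)%N.
Proof.
move=> nm n'm nn'; have [wfx _] := hx; rewrite ltnNge; apply/negP => le.
pose k j := common_prefix (digits hb (x n) j) (digits hb (x n') j) r.
have := @hcut m k (box_of k (digits hb (x n))) le.
rewrite leqNgt => /negP; apply; apply/card_gt1P.
exists (Ordinal nm), (Ordinal n'm); split; rewrite ?inE ?nn'//.
  by apply/(in_elem_boxP hb _ _ (wfx _)).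
apply/(in_elem_boxP hb _ _ (wfx _)) => j i ik.
by rewrite /first_points /= (common_prefix_eq ik).
Qed.

End NetPoints.

(** A linear bound with a constant that is uniform for bounded [y]. *)
Lemma one_add_pow (R : realType) (y Y : R) n : 0 <= y <= Y ->
  (1 + y) ^+ n <= 1 + y * (n%:R * (1 + Y) ^+ n).
Proof.
move=> /andP[y0 yY]; have Y0 := le_trans y0 yY.
elim: n => [|n IH]; first by rewrite expr0 mul0r mulr0 addr0.
have le1 : (1 + y) ^+ n <= (1 + Y) ^+ n by rewrite lerXn2r ?nnegrE ?addr_ge0// lerD2l.
have le2 : (1 + Y) ^+ n <= (1 + Y) ^+ n.+1 by rewrite ler_weXn2l// lerDl.
have n0 : 0 <= n%:R :> R by [].
rewrite exprSr mulrDr mulr1 -natr1 mulrDl mul1r mulrDr addrA.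
apply: lerD.
  by apply: (le_trans IH); rewrite lerD2l ler_wpM2l// ler_wpM2l.
by rewrite mulrC ler_wpM2l// (le_trans le1).
Qed.

Definition close_pair_const (R : realType) (b d t kappa : nat) : R :=
  (b%:R ^+ (2 * d) * b%:R ^+ (2 * (t + 1 + kappa)) * b`!%:R ^+ d) ^+ 2
    * (d%:R * (1 + b`!%:R) ^+ d) * b`!%:R.

Section ClosePairExists.
Variables (disp : measure_display) (Omega : measurableType disp) (R : realType).
Variables (Pr : probability Omega R) (b d t : nat) (hb : (1 < b)%N).
Variable pi : 'I_d -> seq 'I_b -> Omega -> {perm 'I_b}.
Hypothesis hpi : owen_family Pr pi.
Variable x : nat -> bpoint R b d.
Hypothesis hx : td_sequence t x.
Variable kappa : nat.
Hypothesis hcut : forall m : nat,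
  @prefix_cutoff R b d m kappa (@first_points (bpoint R b d) x (b ^ m)).
Variables (k r : nat).
Hypothesis kr : (k <= r)%N.

Let M := (b ^ (d * k + t))%N.

Let b0 : 0 < b%:R :> R. Proof. by rewrite ltr0n; lia. Qed.
Let p0 n : 0 < b%:R ^+ n :> R. Proof. by rewrite exprn_gt0. Qed.
Let pw n : 0 <= b%:R ^+ n :> R. Proof. exact: ltW. Qed.
Let b1 : 1 <= b%:R :> R. Proof. by rewrite ler1n ltnW. Qed.

(** A box of level [(k, ..., k)], given by the digit prefixes of its points. *)
Let box := {ffun 'I_d -> k.-tuple 'I_b}.

Let box_digits (E : box) (j : 'I_d) (h : nat) : 'I_b :=
  nth (bottom_digit hb) (E j) h.

Let pair_exists (E : box) : exists q : nat * nat,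
  [/\ (q.1 < M)%N, (M <= q.2 < 2 * M)%N,
      forall j h, (h < k)%N -> digits hb (x q.1) j h = box_digits E j h &
      forall j h, (h < k)%N -> digits hb (x q.2) j h = box_digits E j h].
Proof.
have [n [/andP[_ n1] n2]] := net_point hb hx 0 k (box_digits E).
have [n' [n'1 n'2]] := net_point hb hx 1 k (box_digits E).
by exists (n, n'); split=> //=; move: n1 n'1; rewrite !mul1n.
Qed.

Let q (E : box) : nat * nat := projT1 (cid (pair_exists E)).

Let qP E : [/\ ((q E).1 < M)%N, (M <= (q E).2 < 2 * M)%N,
      forall j h, (h < k)%N -> digits hb (x (q E).1) j h = box_digits E j h &
      forall j h, (h < k)%N -> digits hb (x (q E).2) j h = box_digits E j h].
Proof. exact: projT2 (cid (pair_exists E)). Qed.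

Let cp E j := common_prefix (digits hb (x (q E).1) j) (digits hb (x (q E).2) j) r.

Let cp_ge E j : (k <= cp E j)%N.
Proof.
have [_ _ H1 H2] := qP E.
by apply: leq_common_prefix => // i ik; rewrite H1// H2.
Qed.

Let cp_sum E : (\sum_j cp E j < d * k + (t + 1 + kappa))%N.
Proof.
have [H1 /andP[H2 H3] _ _] := qP E.
have le2 : (2 * M <= b ^ (d * k + t).+1)%N by rewrite expnS leq_mul2r hb orbT.
have M1 : (M <= 2 * M)%N by rewrite leq_pmull.
have := prefix_sum_lt hb hx hcut r (leq_trans (leq_trans H1 M1) le2)
  (leq_trans H3 le2).
rewrite neq_ltn (leq_trans H1 H2) => /(_ isT).
by rewrite /prefix_sum /cp; lia.
Qed.

Let constraints E js := pair_constraints hb (fun j => digits hb (x (q E).1) j)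
  (fun j => digits hb (x (q E).2) j) r (fun=> bottom_digit hb) js.

Let event E := cylinder pi (constraints E (enum 'I_d)).

Let wt E j : R := weight R (straddle_constraints hb j
  (digits hb (x (q E).1) j) (digits hb (x (q E).2) j) r (bottom_digit hb)
  (ordS (bottom_digit hb))).

Let prob E : R := \prod_j wt E j.

Let probE E : fine (Pr (event E)) = prob E.
Proof.
rewrite /event (cylinder_prob hpi) ?uniq_pair_constraints ?enum_uniq//=.
by rewrite weight_pair_constraints big_enum.
Qed.

(** A lower bound, common to all boxes, for the probability of the constraints
    in one coordinate. *)
Let p : R := b`!%:R^-1 * b%:R ^+ (2 * k) / b%:R ^+ (2 * r).

Let p_gt0 : 0 < p.
Proof. by rewrite divr_gt0// mulr_gt0// invr_gt0 ltr0n fact_gt0. Qed.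

Let p_le1 : p <= 1.
Proof.
rewrite ler_pdivrMr// mul1r; apply: (@le_trans _ _ (b%:R ^+ (2 * k))).
  by rewrite ler_piMl// invf_le1 ?ler1n ?ltr0n fact_gt0.
by rewrite ler_weXn2l//; lia.
Qed.

Let wt_ge E j : p <= wt E j.
Proof.
have /andP[+ _] := weight_straddle hb R j (digits hb (x (q E).1) j)
  (digits hb (x (q E).2) j) r (ordS_neq hb (bottom_digit hb)).
apply: le_trans; rewrite ler_wpM2r ?invr_ge0// ler_wpM2l ?invr_ge0//.
by rewrite ler_weXn2l// leq_mul2l cp_ge.
Qed.

Let prob_ge E : p ^+ d <= prob E.
Proof.
rewrite -[d in p ^+ d]card_ord -prodr_const; apply: ler_prod => j _.
by rewrite (ltW p_gt0) wt_ge.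
Qed.

(** The loss between the lower bound [p ^ d] and an upper bound: the cutoff
    leaves at most [t + 1 + kappa] common digits beyond those of the box. *)
Let B : R := b%:R ^+ (2 * d) * b%:R ^+ (2 * (t + 1 + kappa)) * b`!%:R ^+ d.

Let prob_le E : prob E <= B * p ^+ d.
Proof.
have := weight_pair_le hb R (fun j => digits hb (x (q E).1) j)
  (fun j => digits hb (x (q E).2) j) r (fun=> bottom_digit hb).
rewrite weight_pair_constraints big_enum (eq_bigl xpredT)//= => /le_trans; apply.
have -> : B * p ^+ d = b%:R ^+ (2 * d) / b%:R ^+ (2 * r * d) *
    b%:R ^+ (2 * (d * k + (t + 1 + kappa))).
  rewrite /B /p !exprMn !exprVn -!exprM.
  rewrite (_ : 2 * (d * k + (t + 1 + kappa)) = 2 * (t + 1 + kappa) + 2 * k * d)%N;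
    last by lia.
  rewrite exprD; set X := b`!%:R ^+ d; have X0 : X != 0.
    by rewrite expf_neq0// pnatr_eq0 -lt0n fact_gt0.
  rewrite -!mulrA; congr (_ * _); rewrite [RHS]mulrC -!mulrA; congr (_ * _).
  by rewrite mulVKf.
rewrite ler_wpM2l// ?divr_ge0// ler_weXn2l// leq_mul2l /=.
exact: ltnW (cp_sum E).
Qed.

(** The coordinates in which two boxes share their digit prefix are the only
    ones whose constraints may interact; giving these up for the second box
    costs at most a factor [p^-1] each. *)
Let corr (E E' : box) : R := \prod_j (if E j == E' j then p^-1 else 1).

Let pV_ge1 : 1 <= p^-1. Proof. by rewrite -invr1 lef_pV2 ?posrE. Qed.

Let corr_ge1 E E' : 1 <= corr E E'.
Proof.
rewrite /corr; apply: (big_ind (fun y : R => 1 <= y)) => // [y z|j _].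
  exact: mulr_ege1.
by case: ifP.
Qed.

Let probI_le E E' :
  fine (Pr (event E `&` event E')) <= prob E * prob E' * corr E E'.
Proof.
pose js := [seq j <- enum 'I_d | E j != E' j].
have ujs : uniq js by rewrite filter_uniq// enum_uniq.
have mC C : measurable (cylinder pi C) by apply: measurable_cylinder hpi _.
apply: (@le_trans _ _ (fine (Pr (cylinder pi
    (constraints E (enum 'I_d) ++ constraints E' js))))).
  apply: fine_prob_le; [by apply: measurableI; exact: mC|exact: mC|].
  rewrite cylinder_cat; apply: setIS => w /cylinder_pair H.
  by apply/cylinder_pair => j _; apply: H; rewrite mem_enum.
have prefixE F js' c : c \in constraints F js' ->
    c.1.1 \in js' /\ take k c.1.2 = F c.1.1.
  move=> /mem_pair_constraints[cjs cC]; split=> //.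
  have [_ _ ->] := straddle_sites_prefix (cp_ge F c.1.1) cC.
  have [_ _ H1 _] := qP F.
  apply: (@eq_from_nth _ (bottom_digit hb)); rewrite size_mkseq ?size_tuple// => i ik.
  by rewrite nth_mkseq// H1.
rewrite (cylinder_prob hpi); last first.
  rewrite map_cat cat_uniq !uniq_pair_constraints ?enum_uniq//= andbT.
  apply/hasPn => _ /mapP[c cC' ->]; apply/negP => /mapP[c' cC E1].
  have [cjs E2] := prefixE _ _ _ cC'; have [_] := prefixE _ _ _ cC.
  rewrite -E1 E2 => /val_inj E3.
  by move: cjs; rewrite mem_filter E3 eqxx.
rewrite /= weight_cat !weight_pair_constraints big_enum (eq_bigl xpredT)//=.
rewrite -/(prob E) -mulrA ler_wpM2l//.
  by rewrite (le_trans _ (prob_ge E))// exprn_ge0// ltW.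
rewrite big_filter big_enum_cond /= (eq_bigl (fun j => E j != E' j))//.
rewrite big_mkcond /prob /corr -big_split /=; apply: ler_prod => j _.
rewrite -/(wt E' j); have w0 := lt_le_trans p_gt0 (wt_ge E' j).
case: (E j == E' j) => /=; rewrite ?mulr1 ?(ltW w0) ?lexx ?ler01//=.
by rewrite ler_pdivlMr// mul1r wt_ge.
Qed.

Let K : R := b%:R ^+ k.

Let card_box : #|{: box}|%:R = K ^+ d.
Proof. by rewrite card_ffun card_tuple !card_ord natrX natrX. Qed.

Let sum_corr E : \sum_E' corr E E' <= (K + p^-1) ^+ d.
Proof.
rewrite /corr -(bigA_distr_bigA (fun j e' => if E j == e' then p^-1 else 1)).
rewrite -[d in leRHS]card_ord -prodr_const; apply: ler_prod => j _.
rewrite sumr_ge0/=; last by move=> e' _; case: ifP; rewrite ?invr_ge0 ?(ltW p_gt0).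
rewrite (bigD1 (E j))//= eqxx addrC lerD2r.
apply: (@le_trans _ _ (\sum_(e' : k.-tuple 'I_b) 1)); last first.
  by rewrite sumr_const card_tuple card_ord natrX.
rewrite [leRHS](bigD1 (E j))//= -[leLHS]add0r lerD// ler_sum// => e' ne.
by rewrite eq_sym (negbTE ne).
Qed.

Let no_event : set Omega := [set w | forall E, ~ event E w].

Let CC : R := B ^+ 2 * (d%:R * (1 + b`!%:R) ^+ d).

(** The correlations factor over the coordinates, so that variance over squared
    mean is at most a constant times [(1 + y) ^ d - 1] for
    [y = (b ^ k * p)^-1], which is of order [b ^ (2 * r) / b ^ (3 * k)]. *)
Let no_event_prob : (2 * r <= 3 * k)%N ->
  fine (Pr no_event) <= CC * b`!%:R * b%:R ^+ (2 * r) / b%:R ^+ (3 * k).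
Proof.
move=> rk; pose y : R := (K * p)^-1.
have K0 : 0 < K by exact: p0.
have f0 : 0 < b`!%:R :> R by rewrite ltr0n fact_gt0.
have pd0 : 0 < p ^+ d by rewrite exprn_gt0.
have Kd0 : 0 < K ^+ d by rewrite exprn_gt0.
have B0 : 0 <= B by rewrite !mulr_ge0// exprn_ge0// ltW.
have yE : y = b`!%:R * (b%:R ^+ (2 * r) / b%:R ^+ (3 * k)).
  rewrite /y /K /p (_ : 3 * k = k + 2 * k)%N; last by lia.
  rewrite [b%:R ^+ (k + _)]exprD.
  by field; rewrite !gt_eqF.
have y0 : 0 <= y by rewrite invr_ge0 mulr_ge0// ltW.
have yf : y <= b`!%:R.
  rewrite yE ler_piMr ?(ltW f0)// ler_pdivrMr// mul1r ler_weXn2l//.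
have := @second_moment _ _ _ Pr _ event (fun E => measurable_cylinder hpi _).
under eq_bigr do rewrite probE.
set s1 := \sum_E prob E; set s2 := \sum_E \sum_E' _.
rewrite -/no_event; set z := fine (Pr no_event) => H.
have z0 : 0 <= z by rewrite fine_ge0.
have s1_ge : K ^+ d * p ^+ d <= s1.
  rewrite -card_box mulr_natl -sumr_const.
  exact: ler_sum.
have s12 : s2 - s1 ^+ 2 <= (B * p ^+ d) ^+ 2 * (K ^+ d * ((K + p^-1) ^+ d - K ^+ d)).
  have -> : s1 ^+ 2 = \sum_E \sum_E' prob E * prob E'.
    rewrite expr2 /s1 mulr_suml; apply: eq_bigr => E _.
    by rewrite mulr_sumr.
  rewrite /s2 -sumrB.
  apply: (@le_trans _ _ (\sum_E (B * p ^+ d) ^+ 2 * ((K + p^-1) ^+ d - K ^+ d))).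
    apply: ler_sum => E _; rewrite -sumrB.
    apply: (@le_trans _ _ (\sum_E' (B * p ^+ d) ^+ 2 * (corr E E' - 1))).
      apply: ler_sum => E' _.
      apply: (@le_trans _ _ (prob E * prob E' * (corr E E' - 1))).
        by rewrite mulrBr mulr1 lerD2r probI_le.
      have prob0 F : 0 <= prob F by rewrite (le_trans (ltW pd0)).
      rewrite ler_wpM2r ?subr_ge0// expr2.
      by apply: ler_pM.
    rewrite -mulr_sumr ler_wpM2l ?sqr_ge0// sumrB sumr_const card_box.
    by rewrite lerD2r sum_corr.
  by rewrite sumr_const -mulr_natl card_box mulrCA.
have H1 : (K ^+ d * p ^+ d) ^+ 2 * z <=
    (B * p ^+ d) ^+ 2 * (K ^+ d * ((K + p^-1) ^+ d - K ^+ d)).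
  apply: le_trans s12; apply: le_trans H; rewrite ler_wpM2r//.
  by rewrite lerXn2r// nnegrE ?mulr_ge0 ?(ltW Kd0) ?(ltW pd0)// (le_trans _ s1_ge)//
    mulr_ge0 ?ltW.
have KpE : K + p^-1 = K * (1 + y).
  by rewrite /y; field; rewrite !gt_eqF.
rewrite KpE [(K * (1 + y)) ^+ d]exprMn in H1.
have H2 : z <= B ^+ 2 * ((1 + y) ^+ d - 1).
  have kp0 : 0 < (K ^+ d * p ^+ d) ^+ 2 by rewrite exprn_gt0// mulr_gt0.
  rewrite -(ler_pM2l kp0); apply: (le_trans H1).
  rewrite le_eqVlt; apply/orP; left; apply/eqP; move: (K ^+ d) (p ^+ d) ((1 + y) ^+ d).
  by move=> u v w; ring.
apply: (le_trans H2).
have -> : CC * b`!%:R * b%:R ^+ (2 * r) / b%:R ^+ (3 * k)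
    = B ^+ 2 * (y * (d%:R * (1 + b`!%:R) ^+ d)).
  rewrite yE /CC; move: B (b%:R ^+ (2 * r)) (b%:R ^+ (3 * k))^-1 (_ ^+ d).
  by move=> u v w z'; ring.
have /(one_add_pow d) H3 : 0 <= y <= b`!%:R by rewrite y0.
by rewrite ler_wpM2l ?sqr_ge0// lerBlDl.
Qed.

Let eventP E w : event E w ->
  `|scrambled_point hb pi x w (q E).1 - scrambled_point hb pi x w (q E).2|
    <= 2 / b%:R ^+ r.
Proof.
move=> /cylinder_pair H; apply: row_norm_le => [|j]; first by rewrite divr_ge0.
have /cylinder_straddle Hj : cylinder pi (straddle_constraints hb j
    (digits hb (x (q E).1) j) (digits hb (x (q E).2) j) r (bottom_digit hb)
    (ordS (bottom_digit hb))) w by apply: H; rewrite mem_enum.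
rewrite !mxE; apply: (close_of_straddle _ _ _ Hj) => //.
by apply: scrambled_eq => i; apply: common_prefix_eq.
Qed.

(** The exceptional set [S] is the event that none of the [b ^ (d * k)] pairs,
    one for each box of level [(k, ..., k)], straddles at scale [b ^ - r]. *)
Lemma close_pair_exists : (2 * r <= 3 * k)%N -> exists S : set Omega,
  [/\ measurable S,
      fine (Pr S) <= close_pair_const R b d t kappa * b%:R ^+ (2 * r) / b%:R ^+ (3 * k) &
      forall w, ~ S w -> exists n n', (n < n' < 2 * b ^ (d * k + t))%N /\
        `|scrambled_point hb pi x w n - scrambled_point hb pi x w n'|
          <= 2 / b%:R ^+ r].
Proof.
move=> rk; exists no_event; split; [|exact: no_event_prob|].
  rewrite (_ : no_event = \bigcap_(E in [set: box]) ~` event E).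
    apply: fin_bigcap_measurable => [|E _]; first exact: finite_finset.
    exact/measurableC/(measurable_cylinder hpi).
  by apply/seteqP; split=> w /= H E; [move=> _|]; exact: H.
move=> w nS; have [E HE] : exists E, event E w.
  by apply: contrapT => H; apply: nS => E HE; apply: H; exists E.
have [H1 /andP[H2 H3] _ _] := qP E.
exists (q E).1, (q E).2; split; last exact: eventP.
by rewrite (leq_trans H1 H2).
Qed.

End ClosePairExists.

(** * Separation and covering radius *)

Section DeterministicBounds.
Variables (R : realType) (d : nat).
Implicit Types (z : nat -> 'rV[R]_d) (r : R).

Lemma separation_le z n n1 n2 r : (n1 < n2 < n)%N -> `|z n1 - z n2| <= r ->
  separation z n <= r.
Proof.
move=> n12 le; apply: le_trans le; apply: ge_inf; last by exists n1, n2.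
by exists 0 => _ [? [? [_ ->]]].
Qed.

Lemma separation_ge z n r : (2 <= n)%N ->
  (forall n1 n2, (n1 < n2 < n)%N -> r <= `|z n1 - z n2|) -> r <= separation z n.
Proof.
move=> n2 H; apply: lb_le_inf; last by move=> _ [? [? [/H ? ->]]].
by exists `|z 0%N - z 1%N|, 0%N, 1%N.
Qed.

Let dist_to z n (y : 'rV[R]_d) : R := inf [set `|y - z n'| | n' in `I_n].

Let dist_to_le z n y n' : (n' < n)%N -> dist_to z n y <= `|y - z n'|.
Proof.
by move=> n'n; apply: ge_inf; [exists 0 => _ [? _ <-]|exists n'].
Qed.

Lemma covering_radius_le z n r :
  (forall y, @unit_cube R d y -> exists2 n', (n' < n)%N & `|y - z n'| <= r) ->
  covering_radius z n <= r.
Proof.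
move=> H; apply: ge_sup => [|_ [y cy <-]].
  by exists (dist_to z n 0), 0 => // j; rewrite mxE lexx ler01.
by have [n' n'n] := H y cy; apply: le_trans; exact: dist_to_le.
Qed.

Lemma covering_radius_ge z n y r : (0 < n)%N -> @unit_cube R d y ->
  (forall n', (n' < n)%N -> r <= `|y - z n'|) -> r <= covering_radius z n.
Proof.
move=> n0 cy H; apply: (@le_trans _ _ (dist_to z n y)).
  by apply: lb_le_inf => [|_ [n' n'n <-]]; [exists `|y - z 0%N|, 0%N|exact: H].
apply: ub_le_sup; last by exists y.
exists (1 + `|z 0%N|) => _ [y' cy' <-].
apply: (le_trans (dist_to_le z y' n0)); apply: (le_trans (ler_normB _ _)).
rewrite lerD2r; apply: row_norm_le => // j.
by have /andP[y0 y1] := cy' j; rewrite ger0_norm.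
Qed.

(** Fewer than [K ^ d] points miss one of the [K ^ d] cells of a grid, each
    point being close to the centre of at most one cell. *)
Lemma covering_radius_grid z n K : (0 < n < K ^ d)%N ->
  (2 * K%:R)^-1 <= covering_radius z n.
Proof.
move=> /andP[n0 nK].
have K0 : (0 < K)%N.
  have le1 : (0 ^ d <= 1)%N by case: (d) => // d'; rewrite exp0n.
  by case: (posnP K) nK => // -> nK; lia.
have KR : 0 < K%:R :> R by rewrite ltr0n.
pose center (E : {ffun 'I_d -> 'I_K}) : 'rV[R]_d :=
  \row_j ((2 * (E j : nat)%:R + 1) / (2 * K%:R)).
have cube E : @unit_cube R d (center E).
  move=> j; rewrite mxE divr_ge0 ?addr_ge0 ?mulr_ge0//=.
  rewrite ler_pdivrMr ?mulr_gt0// mul1r -natrM -[1]/(1%:R) -natrD -natrM ler_nat.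
  by have := ltn_ord (E j); lia.
have [/existsP[E /forallP H]|/existsPn H] := boolP [exists E : {ffun 'I_d -> 'I_K},
    [forall n' : 'I_n, (2 * K%:R)^-1 <= `|center E - z n'|]].
  by apply: (covering_radius_ge n0 (cube E)) => n' n'n; exact: (H (Ordinal n'n)).
have near E : exists n' : 'I_n, `|center E - z n'| < (2 * K%:R)^-1.
  by have /forallPn[n'] := H E; rewrite -ltNge; exists n'.
have [f fP] := choice near.
have finj : injective f.
  move=> E E' ff; apply/ffunP => j; apply: val_inj; apply/eqP.
  have lt : `|center E 0 j - center E' 0 j| < K%:R^-1.
    apply: (@le_lt_trans _ _ `|center E - center E'|).
      by apply: le_trans (entry_le_norm _ j); rewrite !mxE.
    apply: (le_lt_trans (ler_distD (z (f E)) _ _)).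
    have -> : K%:R^-1 = (2 * K%:R)^-1 + (2 * K%:R)^-1 :> R.
      by field; rewrite gt_eqF.
    by rewrite ltrD// distrC ff.
  move: lt; rewrite !mxE.
  have -> : (2 * (E j)%:R + 1) / (2 * K%:R) - (2 * (E' j)%:R + 1) / (2 * K%:R)
     = ((E j)%:R - (E' j)%:R) / K%:R :> R by field; rewrite gt_eqF.
  rewrite normrM normfV [X in _ / X]gtr0_norm// -ltr_pdivlMr ?invr_gt0//.
  rewrite divff ?invr_eq0 ?(lt0r_neq0 KR)// => lt.
  have [l1 l2] : (E j < (E' j).+1)%N /\ (E' j < (E j).+1)%N.
    move: lt; rewrite ltr_norml => /andP[? ?].
    by split; rewrite -(ltr_nat R) -natr1; lra.
  by rewrite eqn_leq; apply/andP; split; [exact: l1|exact: l2].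
have := leq_card f finj; rewrite card_ffun !card_ord.
by rewrite leqNgt nK.
Qed.

End DeterministicBounds.

Section NetCovering.
Variables (R : realType) (b d t : nat) (hb : (1 < b)%N).
Variable x : nat -> bpoint R b d.
Hypothesis hx : td_sequence t x.
Variable p : 'I_d -> seq 'I_b -> {perm 'I_b}.

Let b0 n : 0 < b%:R ^+ n :> R. Proof. by rewrite exprn_gt0// ltr0n; lia. Qed.

Lemma unit_interval_digits (y : R) (k : nat) : 0 <= y <= 1 ->
  exists tau : nat -> 'I_b, (prefix_index tau k)%:R / b%:R ^+ k <= y
     <= (prefix_index tau k).+1%:R / b%:R ^+ k.
Proof.
move=> /andP[y0]; rewrite le_eqVlt => /orP[/eqP->|y1].
  (* The endpoint 1 lies in the last closed cell. *)
  exists (fun=> top_digit hb).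
  have -> : (prefix_index (fun=> top_digit hb) k).+1 = (b ^ k)%N.
    elim: k => [|k IH]; first by rewrite /prefix_index big_ord0.
    rewrite prefix_indexS expnSr -IH /=; nia.
  rewrite natrX divff ?gt_eqF// lexx andbT ler_pdivrMr// mul1r -natrX ler_nat.
  exact/ltnW/prefix_index_lt.
exists (regular_digit hb y); rewrite prefix_index_regular ?y0//.
rewrite ler_pdivrMr// ler_pdivlMr//.
have /andP[-> /ltW->//] : (Num.truncn (y * b%:R ^+ k))%:R <= y * b%:R ^+ k
    < (Num.truncn (y * b%:R ^+ k)).+1%:R.
by rewrite truncn_itv// mulr_ge0// ltW.
Qed.

(** Scrambling permutes the boxes of level [(k, ..., k)], so that each of them
    still contains a point of the net. *)
Lemma covering_radius_net k n : (b ^ (d * k + t) <= n)%N ->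
  covering_radius (fun n => scramble hb p (x n)) n <= (b%:R ^+ k)^-1.
Proof.
move=> kn; apply: covering_radius_le => y cy.
have /choice[tau tauP] : forall j, exists tau : nat -> 'I_b,
    (prefix_index tau k)%:R / b%:R ^+ k <= y 0 j
     <= (prefix_index tau k).+1%:R / b%:R ^+ k.
  by move=> j; apply: unit_interval_digits.
have /choice[u uP] : forall j, exists u, forall i, (i < k)%N ->
    scrambled (p j) u i = tau j i by move=> j; apply: scrambled_surj.
have [n' [/andP[_ n'1] n'2]] := net_point hb hx 0 k u.
rewrite mul1n in n'1; exists n'; first exact: leq_trans kn.
apply: row_norm_le => [|j]; first by rewrite invr_ge0 ltW.
rewrite !mxE -/(scrambled (p j) (digits hb (x n') j)).
have := digits_value_bounds R hb (scrambled (p j) (digits hb (x n') j)) k.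
have -> : prefix_index (scrambled (p j) (digits hb (x n') j)) k
    = prefix_index (tau j) k.
  apply/prefix_index_inj => i ik.
  by rewrite (scrambled_eq _ (n'2 j))// uP.
move=> /andP[v1 v2]; have /andP[w1 w2] := tauP j.
move: v2 w2; rewrite -natr1 mulrDl mul1r => v2 w2.
by rewrite ler_norml; apply/andP; split; lra.
Qed.

End NetCovering.

(** * Growth on the logarithmic scale *)

Section LogGrowth.
Variable R : realType.
Implicit Types u v : nat -> R.

(** [u n = alpha * ln n + o(ln n)], in the form in which interpolation between
    the powers of a base delivers it. *)
Definition log_growth u (alpha : R) : Prop :=
  forall eps : R, 0 < eps -> exists (C : R) (n0 : nat), forall n, (n0 <= n)%N ->
    `|u n - alpha * ln n%:R| <= eps * ln n%:R + C.

Lemma log_growthB u v alpha beta : log_growth u alpha -> log_growth v beta ->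
  log_growth (fun n => u n - v n) (alpha - beta).
Proof.
move=> hu hv eps e0; have e2 : 0 < eps / 2 by rewrite divr_gt0.
have [C [n0 H]] := hu _ e2; have [D [n1 K]] := hv _ e2.
exists (C + D), (maxn n0 n1) => n; rewrite geq_max => /andP[/H hn /K kn].
have -> : u n - v n - (alpha - beta) * ln n%:R =
  (u n - alpha * ln n%:R) - (v n - beta * ln n%:R) by ring.
apply: (le_trans (ler_normB _ _)); apply: (le_trans (lerD hn kn)).
by rewrite le_eqVlt; apply/orP; left; apply/eqP; field.
Qed.

Lemma ln_natr_ge (M : R) : exists n0, forall n, (n0 <= n)%N -> M <= ln n%:R.
Proof.
exists (Num.truncn (expR M)).+1 => n hn.
rewrite -[M]expRK ler_ln ?posrE ?expR_gt0//.
  apply: ltW; apply: lt_le_trans (_ : (Num.truncn (expR M)).+1%:R <= _).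
    exact: truncnS_gt.
  by rewrite ler_nat.
by rewrite ltr0n; lia.
Qed.

Lemma log_growth_cvg u alpha : log_growth u alpha ->
  (fun n => u n / ln n%:R) @ \oo --> alpha.
Proof.
move=> hu; apply/cvgrPdist_le => eps e0.
have [|C [n0 H]] := hu (eps / 2); first by rewrite divr_gt0.
have [n1 L1] := ln_natr_ge 1; have [n2 L2] := ln_natr_ge (2 * C / eps).
exists (maxn n0 (maxn n1 n2)) => // n /=.
rewrite !geq_max => /and3P[/H hn /L1 l1 /L2 l2].
have l0 : 0 < ln n%:R :> R by apply: lt_le_trans l1.
have -> : alpha - u n / ln n%:R = - ((u n - alpha * ln n%:R) / ln n%:R).
  by field; rewrite gt_eqF.
rewrite normrN normrM normfV (gtr0_norm l0) ler_pdivrMr//.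
apply: (le_trans hn); move: l2; rewrite ler_pdivrMr// => l2.
by rewrite -lerBrDl; apply: (@le_trans _ _ (eps * ln n%:R / 2)); lra.
Qed.

End LogGrowth.

Section LogSlopes.
Variables (R : realType) (b : nat).
Hypothesis hb : (1 < b)%N.

Let lb : R := ln b%:R.

Let lb_gt0 : 0 < lb. Proof. by rewrite ln_gt0// ltr1n. Qed.

Let b0 n : 0 < b%:R ^+ n :> R. Proof. by rewrite exprn_gt0// ltr0n; lia. Qed.

Let ln_pow n : ln (b%:R ^+ n) = n%:R * lb :> R.
Proof. by rewrite lnXn ?ltr0n; [rewrite mulr_natl|lia]. Qed.

Let ln_powV n : ln (b%:R ^+ n)^-1 = - (n%:R * lb) :> R.
Proof. by rewrite lnV ?posrE// ln_pow. Qed.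

Lemma ln_natr_bracket n m : (0 < m)%N -> (0 < n)%N ->
  let l := trunc_log (b ^ m) n in
  [/\ (b ^ (m * l) <= n < b ^ (m * l.+1))%N, (m * l)%:R * lb <= ln n%:R &
      ln n%:R <= (m * l.+1)%:R * lb].
Proof.
move=> m0 n0 l; have bm : (1 < b ^ m)%N by rewrite -(exp1n m) ltn_exp2r.
have /= := trunc_log_bounds bm n0; rewrite -/l -!expnM => /andP[h1 h2].
rewrite h1 h2; split=> //; rewrite -ln_pow ler_ln ?posrE ?ltr0n// -natrX ler_nat//.
exact: ltnW.
Qed.

Variables (d t : nat).
Hypothesis hd : (0 < d)%N.
Variable z : nat -> 'rV[R]_d.

Hypothesis cover_le : forall k n, (b ^ (d * k + t) <= n)%N ->
  covering_radius z n <= (b%:R ^+ k)^-1.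

Let cover_ge k n : (0 < n < b ^ (d * k))%N ->
  (2 * b%:R ^+ k)^-1 <= covering_radius z n.
Proof.
move=> nk; have := @covering_radius_grid R d z n (b ^ k).
by rewrite -expnM mulnC natrX => /(_ nk).
Qed.

Lemma covering_radius_gt0 n : (0 < n)%N -> 0 < covering_radius z n.
Proof.
move=> n0; apply: (@lt_le_trans _ _ (2 * b%:R ^+ n)^-1).
  by rewrite invr_gt0 mulr_gt0.
apply: cover_ge; rewrite n0 /=.
apply: (leq_trans (ltn_expl n hb)); rewrite leq_exp2l//.
by rewrite leq_pmull.
Qed.

Lemma log_growth_covering_radius :
  log_growth (fun n => ln (covering_radius z n)) (- d%:R^-1).
Proof.
move=> eps e0; exists (ln 2 + t.+1%:R * lb), (b ^ (d * t))%N => n nt.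
have n0 : (0 < n)%N by apply: leq_trans nt; rewrite expn_gt0 ltnW.
have [/andP[h1 h2] h3 h4] := ln_natr_bracket hd n0.
set l := trunc_log (b ^ d) n in h1 h2 h3 h4.
have d0 : 0 < d%:R :> R by rewrite ltr0n.
have lt : (t <= l)%N.
  by rewrite -ltnS -(ltn_pmul2l hd) -(ltn_exp2l _ _ hb) (leq_ltn_trans nt).
have ln0 : 0 <= ln n%:R :> R by rewrite ln_ge0// ler1n.
have ln2 : 0 <= ln 2 :> R by rewrite ln_ge0// ler1n.
have hc := covering_radius_gt0 n0.
have lower : - ln 2 - l.+1%:R * lb <= ln (covering_radius z n).
  have -> : - ln 2 - l.+1%:R * lb = ln (2 * b%:R ^+ l.+1)^-1.
    by rewrite lnV ?posrE ?mulr_gt0// lnM ?posrE// ln_pow opprD.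
  by rewrite ler_ln ?posrE ?invr_gt0 ?mulr_gt0// cover_ge// n0.
have upper : ln (covering_radius z n) <= - ((l - t)%:R * lb).
  rewrite -ln_powV ler_ln ?posrE ?invr_gt0// cover_le//.
  apply: leq_trans h1; rewrite leq_exp2l// mulnBr.
  have h5 : (t <= d * t)%N by rewrite leq_pmull.
  have h6 : (d * t <= d * l)%N by rewrite leq_mul2l lt orbT.
  by lia.
rewrite natrB// in upper.
move: h3 h4; rewrite !natrM -!mulrA => h3 h4.
have h3' : l%:R * lb <= ln n%:R / d%:R by rewrite ler_pdivlMr// mulrC.
have h4' : ln n%:R / d%:R <= l.+1%:R * lb by rewrite ler_pdivrMr// mulrC.
have eln : 0 <= eps * ln n%:R by rewrite mulr_ge0// ltW.
have tl : 0 <= t%:R * lb by rewrite mulr_ge0// ltW.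
rewrite mulNr opprK [d%:R^-1 * _]mulrC ler_norml.
rewrite -![l.+1%:R]natr1 -?[t.+1%:R]natr1 !mulrDl !mul1r in lower h4' *; rewrite mulrBl in upper.
by apply/andP; split; lra.
Qed.

(** The scales [(3 * q + 1) * l] and [(3 * q - 1) * l] enclose the critical one,
    [3 * q * l]; the factor [2] in the level [2 * q * l] makes the latter an
    integer. *)
Hypothesis far : forall q, (0 < q)%N -> exists l0, forall l, (l0 <= l)%N ->
  forall n n', (n < b ^ (d * (2 * q * l)))%N -> (n' < b ^ (d * (2 * q * l)))%N ->
  n != n' -> (b%:R ^+ ((3 * q + 1) * l))^-1 <= `|z n - z n'|.

Hypothesis close : forall q, (0 < q)%N -> exists l0, forall l, (l0 <= l)%N ->
  exists n n', (n < n' < 2 * b ^ (d * (2 * q * l) + t))%N /\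
    `|z n - z n'| <= 2 / b%:R ^+ ((3 * q - 1) * l).

Lemma separation_gt0 : exists n0, forall n, (n0 <= n)%N -> 0 < separation z n.
Proof.
have [l0 H] := far (isT : (0 < 1)%N); exists 2%N => n n2.
pose l := (l0 + n)%N.
apply: (@lt_le_trans _ _ (b%:R ^+ ((3 * 1 + 1) * l))^-1).
  by rewrite invr_gt0.
have nl : (n < b ^ (d * (2 * 1 * l)))%N.
  apply: (leq_trans (ltn_expl n hb)); rewrite leq_exp2l//.
  by apply: (@leq_trans (2 * 1 * l)); [rewrite /l; lia|rewrite leq_pmull].
apply: separation_ge => // n1 n1' /andP[n12 n2n]; apply: H.
- exact: leq_addr.
- exact: ltn_trans (ltn_trans n12 n2n) nl.
- exact: ltn_trans n2n nl.
- by rewrite neq_ltn n12.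
Qed.

(** Between [b ^ (m * l)] and [b ^ (m * l.+1)], for [m = 2 * q * d], the bounds
    at [l.+1] and [l - t.+1] enclose the logarithm of the separation; moving the
    index [l] by a bounded amount only changes the additive constant. *)
Lemma log_growth_separation :
  log_growth (fun n => ln (separation z n)) (- (3 / (2 * d%:R))).
Proof.
(* The enclosing slopes miss [3 / (2 * d)] by [1 / (2 * q * d)]. *)
move=> eps e0; pose q := (Num.truncn eps^-1).+1.
have q0 : (0 < q)%N by [].
have [l1 H1] := far q0; have [l2 H2] := close q0.
have [n1 sep0] := separation_gt0.
pose m := (2 * q * d)%N; have m0 : (0 < m)%N by rewrite !muln_gt0.
have mulE k : (d * (2 * q * k) = m * k)%N by rewrite mulnA [(d * _)%N]mulnC.
pose C : R := ln 2 + (3 * q + 1)%:R * (t.+2)%:R * lb.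
exists C, (maxn 2 (maxn n1 (b ^ (m * (l1 + l2 + t.+1)))))%N => n.
rewrite !geq_max => /and3P[n2 nn1 nl].
have n0 : (0 < n)%N by apply: ltnW.
have sp := sep0 n nn1.
have [/andP[h1 h2] h3 h4] := ln_natr_bracket m0 n0.
set l := trunc_log (b ^ m) n in h1 h2 h3 h4.
have ll : (l1 + l2 + t.+1 <= l)%N.
  by rewrite -ltnS -(ltn_pmul2l m0) -(ltn_exp2l _ _ hb) (leq_ltn_trans nl).
have d0 : 0 < d%:R :> R by rewrite ltr0n.
have qR : 0 < q%:R :> R by rewrite ltr0n.
have ln0 : 0 <= ln n%:R :> R by rewrite ln_ge0// ler1n.
have ln2 : 0 <= ln 2 :> R by rewrite ln_ge0// ler1n.
have lower : - ((3 * q + 1)%:R * l.+1%:R * lb) <= ln (separation z n).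
  rewrite -natrM -ln_powV ler_ln ?posrE ?invr_gt0//.
  apply: separation_ge => // i i' /andP[ii' i'n].
  have lt : (n < b ^ (d * (2 * q * l.+1)))%N.
    by rewrite mulE.
  apply: H1; first by clear -ll; lia.
  - exact: ltn_trans (ltn_trans ii' i'n) lt.
  - exact: ltn_trans i'n lt.
  - by rewrite neq_ltn ii'.
(* Stepping back by [t.+1] makes room for the factor [2 * b ^ t]. *)
have upper : ln (separation z n) <= ln 2 - (3 * q - 1)%:R * (l - t.+1)%:R * lb.
  have [|i [i' [/andP[ii' i'n] le]]] := H2 (l - t.+1)%N; first by clear -ll; lia.
  have lnE : ln 2 - (3 * q - 1)%:R * (l - t.+1)%:R * lb
      = ln (2 / b%:R ^+ ((3 * q - 1) * (l - t.+1))).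
    by rewrite lnM ?posrE ?invr_gt0// ln_powV natrM.
  rewrite lnE ler_ln ?posrE ?divr_gt0//; apply: (separation_le _ le).
  rewrite ii' /=; apply: leq_trans i'n _; apply: leq_trans h1.
  apply: (@leq_trans (b * b ^ (d * (2 * q * (l - t.+1)) + t))).
    by rewrite leq_mul2r hb orbT.
  have tl : (t.+1 <= l)%N by clear -ll; lia.
  rewrite -expnS leq_exp2l// mulE mulnBr -addnS.
  have tm : (t.+1 <= m * t.+1)%N by rewrite leq_pmull.
  have ml : (m * t.+1 <= m * l)%N by rewrite leq_mul2l tl orbT.
  by apply: (@leq_trans (m * l - m * t.+1 + m * t.+1)); [rewrite leq_add2l|rewrite subnK].
pose s : R := ln n%:R / (2 * q%:R * d%:R).
have sE : 3 / (2 * d%:R) * ln n%:R = 3 * q%:R * s.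
  by rewrite /s; field; rewrite !gt_eqF.
have m_gt0 : 0 < 2 * q%:R * d%:R :> R by rewrite !mulr_gt0.
have s0 : 0 <= s by rewrite divr_ge0// ltW.
have s_eps : s <= eps * ln n%:R.
  rewrite /s mulrC ler_wpM2r//.
  have qe : q%:R^-1 <= eps.
    by rewrite -[eps]invrK lef_pV2 ?posrE ?invr_gt0// ltW// truncnS_gt.
  apply: le_trans qe; rewrite lef_pV2 ?posrE//.
  by rewrite -!natrM ler_nat mulnC mulnA leq_pmull// muln_gt0 hd.
have mE : m%:R = 2 * q%:R * d%:R :> R by rewrite !natrM.
have sl : l%:R * lb <= s by rewrite ler_pdivlMr// -mE mulrC mulrA -natrM.
have sl1 : s <= l.+1%:R * lb by rewrite ler_pdivrMr// -mE mulrC mulrA -natrM.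
have low2 : (3 * q + 1)%:R * l.+1%:R * lb <= (3 * q + 1)%:R * (s + lb).
  by rewrite -mulrA ler_wpM2l// -natr1 mulrDl mul1r lerD2r.
have upp2 : (3 * q - 1)%:R * (s - t.+2%:R * lb)
    <= (3 * q - 1)%:R * (l - t.+1)%:R * lb.
  rewrite -mulrA ler_wpM2l//.
  have -> : (l - t.+1)%:R = l.+1%:R - t.+2%:R :> R.
    by rewrite -natrB ?subSS// ltnS (leq_trans _ ll)// leq_addl.
  by rewrite mulrBl lerD2r.
have q3 : (3 * q - 1)%:R = 3 * q%:R - 1 :> R by rewrite natrB ?natrM// muln_gt0.
have q3' : (3 * q + 1)%:R = 3 * q%:R + 1 :> R by rewrite natrD natrM.
have tlb : lb <= t.+2%:R * lb by rewrite ler_peMl ?ler1n// ltW.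
have T0 : 0 <= t.+2%:R * lb by rewrite mulr_ge0// ltW.
have qT : 0 <= q%:R * (t.+2%:R * lb) by rewrite mulr_ge0// ltW.
have qlb : q%:R * lb <= q%:R * (t.+2%:R * lb) by rewrite ler_wpM2l// ltW.
have lower' : - ((3 * q%:R + 1) * (s + lb)) <= ln (separation z n).
  by apply: le_trans lower; rewrite lerN2 -q3'.
have upper' : ln (separation z n) <= ln 2 - (3 * q%:R - 1) * (s - t.+2%:R * lb).
  by apply: (le_trans upper); rewrite lerD2l lerN2 -q3.
rewrite mulNr opprK sE /C q3' -[_ * _ * lb]mulrA.
move: s0 s_eps tlb T0 qT qlb lower' upper' ln2; clear.
move: (ln (separation z n)) (t.+2%:R * lb) (eps * ln n%:R) (ln 2).
clearbody lb; move: s q%:R lb => s Q L S T E W.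
move=> s0 s_eps tlb T0 qT qlb lower upper ln2.
by rewrite ler_norml; apply/andP; split; lra.
Qed.

End LogSlopes.

(** * Almost sure bounds *)

Section BorelCantelli.
Variables (disp : measure_display) (Omega : measurableType disp) (R : realType).
Variable Pr : probability Omega R.

(** The Borel-Cantelli lemma for geometrically decreasing probabilities. *)
Lemma ae_eventually_notin (F : nat -> set Omega) (C : R) :
  (forall l, measurable (F l)) -> (forall l, fine (Pr (F l)) <= C / 2 ^+ l) ->
  {ae Pr, forall w, exists l0, forall l, (l0 <= l)%N -> ~ F l w}.
Proof.
move=> mF PF; exists (lim_sup_set F); split.
- apply: bigcap_measurable => [|n _]; first by exists 0%N.
  by apply: bigcup_measurable.
- apply: lim_sup_set_cvg0 => //.
  apply: (@le_lt_trans _ _ (\sum_(0 <= k <oo) ((C * 2) / (2 ^ (k + 1))%:R)%:E)%E).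
    apply: lee_nneseries => [k _ _|k _]; first exact: measure_ge0.
    rewrite -[leLHS]fineK ?fin_num_measure// lee_fin.
    apply: (le_trans (PF k)).
    by rewrite natrX exprD expr1 invfM mulrACA divff ?mulr1.
  by rewrite (cvg_lim _ (@cvg_geometric_eseries_half R (C * 2) 0))// ltry.
- move=> w /= nw n _; apply: contrapT => H; apply: nw; exists n => l nl Fl.
  by apply: H; exists l.
Qed.

End BorelCantelli.

Section AlmostSureBounds.
Variables (disp : measure_display) (Omega : measurableType disp) (R : realType).
Variables (Pr : probability Omega R) (b d t : nat) (hb : (1 < b)%N).
Variable pi : 'I_d -> seq 'I_b -> Omega -> {perm 'I_b}.
Hypothesis hpi : owen_family Pr pi.
Variable x : nat -> bpoint R b d.
Hypothesis hx : td_sequence t x.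
Variable kappa : nat.
Hypothesis hcut : forall m : nat,
  @prefix_cutoff R b d m kappa (@first_points (bpoint R b d) x (b ^ m)).

Let xt := scrambled_point hb pi x.

Let p0 n : 0 < b%:R ^+ n :> R. Proof. by rewrite exprn_gt0// ltr0n; lia. Qed.
Let pw n : 0 <= b%:R ^+ n :> R. Proof. exact: ltW. Qed.
Let b1 : 1 <= b%:R :> R. Proof. by rewrite ler1n ltnW. Qed.

Let two_pow l : 2 ^+ l <= b%:R ^+ l :> R.
Proof. by rewrite lerXn2r ?nnegrE// ler_nat. Qed.

Lemma ae_close_pairs : {ae Pr, forall w q, (0 < q)%N -> exists l0, forall l,
  (l0 <= l)%N -> exists n n', (n < n' < 2 * b ^ (d * (2 * q * l) + t))%N /\
    `|xt w n - xt w n'| <= 2 / b%:R ^+ ((3 * q - 1) * l)}.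
Proof.
apply/ae_foralln => q; case: (posnP q) => [->|q0]; first by apply: aeW.
have ex l := @close_pair_exists _ _ R Pr b d t hb pi hpi x hx kappa hcut
  (2 * q * l) ((3 * q - 1) * l).
have /choice[S SP] : forall l, exists S : set Omega,
  [/\ measurable S, fine (Pr S) <= close_pair_const R b d t kappa / 2 ^+ l &
      forall w, ~ S w -> exists n n', (n < n' < 2 * b ^ (d * (2 * q * l) + t))%N /\
        `|xt w n - xt w n'| <= 2 / b%:R ^+ ((3 * q - 1) * l)].
  move=> l; have le_ql : (l <= q * l)%N by rewrite leq_pmull.
  have rE : ((3 * q - 1) * l = 3 * (q * l) - l)%N by rewrite mulnBl mul1n mulnA.
  have [||S [mS PS HS]] := ex l; [by clear -le_ql rE; lia|by clear -le_ql rE; lia|].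
  exists S; split=> //; apply: (le_trans PS); rewrite -mulrA.
  have C0 : 0 <= close_pair_const R b d t kappa.
    by rewrite !mulr_ge0// ?sqr_ge0// exprn_ge0// addr_ge0.
  rewrite ler_wpM2l// ler_pdivrMr//.
  rewrite (_ : 3 * (2 * q * l) = 2 * ((3 * q - 1) * l) + 2 * l)%N; last first.
    by clear -le_ql rE; lia.
  rewrite exprD mulrCA ler_peMr//.
  rewrite mulrC ler_pdivlMr ?exprn_gt0// mul1r; apply: (le_trans (two_pow l)).
  by rewrite ler_weXn2l// leq_pmull.
have mS l : measurable (S l) by have [] := SP l.
have PS l : fine (Pr (S l)) <= close_pair_const R b d t kappa / 2 ^+ l.
  by have [] := SP l.
apply: filterS (ae_eventually_notin mS PS) => w [l0 wl0] _.
by exists l0 => l ll0; have [_ _] := SP l; apply; apply: wl0.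
Qed.

Hypothesis hd : (0 < d)%N.
Variable A : R.
Hypothesis A0 : 0 <= A.
Hypothesis hcoinc : forall m : nat,
  coincidence_bound A (@first_points (bpoint R b d) x (b ^ m)).

Lemma ae_far_pairs : {ae Pr, forall w q, (0 < q)%N -> exists l0, forall l,
  (l0 <= l)%N -> forall n n', (n < b ^ (d * (2 * q * l)))%N ->
  (n' < b ^ (d * (2 * q * l)))%N -> n != n' ->
  (b%:R ^+ ((3 * q + 1) * l))^-1 <= `|xt w n - xt w n'|}.
Proof.
have [wfx _] := hx.
apply/ae_foralln => q; case: (posnP q) => [->|q0]; first by apply: aeW.
(* [l.+1 <= b ^ l] absorbs the polynomial factor in half of the decay
   [b ^ - (2 * l * d)] of the main term. *)
pose K : R := ((2 * b) ^ d)%:R * b%:R ^+ (2 * d) * (A * b%:R ^+ kappa).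
have K0 : 0 <= K by rewrite !mulr_ge0.
pose F l := close_event hb pi x (b ^ (d * (2 * q * l))) ((3 * q + 1) * l).
have mF l : measurable (F l) := measurable_close_event hb hpi _ _ _.
have PF l : fine (Pr (F l)) <= (K * (3 * q + 1)%:R ^+ d) / 2 ^+ l.
  apply: (le_trans (close_event_prob hb wfx A0 (hcoinc _) (@hcut _) hpi _)).
  rewrite -/K; set r := ((3 * q + 1) * l)%N.
  rewrite -!(mulrA K) ler_wpM2l//.
  have r1 : r.+1%:R ^+ d <= (3 * q + 1)%:R ^+ d * b%:R ^+ (l * d) :> R.
    rewrite exprM -exprMn lerXn2r ?nnegrE ?mulr_ge0//.
    apply: (@le_trans _ _ ((3 * q + 1)%:R * l.+1%:R)).
      by rewrite -natrM ler_nat /r mulnS -add1n leq_add2r addn1.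
    by rewrite ler_wpM2l// -natrX ler_nat ltn_expl.
  apply: (@le_trans _ _ ((3 * q + 1)%:R ^+ d * b%:R ^+ (l * d) *
      (b%:R ^+ (3 * (d * (2 * q * l))) / b%:R ^+ (2 * r * d)))).
    by rewrite -mulrA ler_wpM2r// divr_ge0.
  rewrite -mulrA ler_wpM2l ?exprn_ge0//.
  rewrite mulrA -exprD ler_pdivrMr//.
  have -> : (2 * r * d = (l * d + 3 * (d * (2 * q * l))) + l * d)%N.
    by rewrite /r; clear; lia.
  rewrite [b%:R ^+ (_ + l * d)]exprD mulrCA ler_peMr//.
  rewrite mulrC ler_pdivlMr ?exprn_gt0// mul1r; apply: (le_trans (two_pow l)).
  by rewrite ler_weXn2l// leq_pmulr.
apply: filterS (ae_eventually_notin mF PF) => w [l0 wl0] _.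
exists l0 => l ll0 n n' nN n'N nn'.
exact: (close_eventP (wl0 l ll0)).
Qed.

End AlmostSureBounds.

Section ExtendedLogarithms.
Variable R : realType.

Lemma lne_ratio_cvg (f : nat -> \bar R) (g : nat -> R) (alpha : R) (n0 : nat) :
  (forall n, (n0 <= n)%N -> 0 < g n /\ f n = (g n)%:E) ->
  log_growth (fun n => ln (g n)) alpha ->
  (fun n : nat => (lne (f n) / lne n%:R%:E)%E) @ \oo --> alpha%:E.
Proof.
move=> fg /log_growth_cvg cv.
apply: cvg_trans (_ : (fun n => (ln (g n) / ln n%:R)%:E) @ \oo --> alpha%:E).
  apply: near_eq_cvg; exists (maxn n0 2) => // n; rewrite [X in X -> _]/=.
  rewrite geq_max => /andP[/fg[g0 ->] n2].
  have n_gt0 : 0 < n%:R :> R by rewrite ltr0n; apply: ltnW.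
  by rewrite (lne_EFin g0) (lne_EFin n_gt0) inver gt_eqF ?ln_gt0 ?ltr1n.
by apply: cvg_EFin => //; apply: nearW.
Qed.

Lemma unbounded_of_log_growth (g : nat -> R) (alpha c : R) (n0 : nat) :
  0 < alpha -> log_growth (fun n => ln (g n)) alpha ->
  (forall n, (n0 <= n)%N -> 0 < g n) ->
  ~ (forall n, (n0 <= n)%N -> g n <= c).
Proof.
move=> a0 hg g0 gc; have a2 : 0 < alpha / 2 by rewrite divr_gt0.
have [C [n1 H]] := hg _ a2.
have [n2 L] := ln_natr_ge ((ln c + C + 1) / (alpha / 2)).
pose n := maxn n0 (maxn n1 n2).
have nn0 : (n0 <= n)%N by rewrite leq_maxl.
have /H : (n1 <= n)%N by rewrite /n maxnCA leq_maxl.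
have /L : (n2 <= n)%N by rewrite /n maxnA leq_maxr.
rewrite ler_pdivrMr// ler_norml => L1 /andP[L2 _].
have gn := g0 n nn0; have : ln (g n) <= ln c.
  by rewrite ler_ln ?posrE// ?gc//; apply: lt_le_trans gn (gc n nn0).
by move=> L3; lra.
Qed.

End ExtendedLogarithms.

Theorem corollary4p13 (R : realType) (b d t : nat)
    (hb : (1 < b)%N) (hd : (0 < d)%N)
    (x : nat -> bpoint R b d) (hx : td_sequence t x)
    (A : R) (kappa : nat) (hA : 1 <= A)
    (hcoinc : forall m : nat,
       coincidence_bound A (@first_points (bpoint R b d) x (b ^ m)))
    (hcut : forall m : nat,
       @prefix_cutoff R b d m kappa (@first_points (bpoint R b d) x (b ^ m)))
    (disp : measure_display) (Omega : measurableType disp)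
    (Pr : probability Omega R)
    (pi : 'I_d -> seq 'I_b -> Omega -> {perm 'I_b})
    (hpi : owen_family Pr pi) :
  let xt (w : Omega) (n : nat) : 'rV[R]_d :=
    scramble hb (fun j u => pi j u w) (x n) in
  {ae Pr, forall w : Omega,
     ((fun n : nat => (lne (separation (xt w) n)%:E / lne n%:R%:E)%E)
        @ \oo --> (- (3 / (2 * d%:R)) : R)%:E) /\
     ((fun n : nat => (lne (mesh_ratio (xt w) n) / lne n%:R%:E)%E)
        @ \oo --> (1 / (2 * d%:R) : R)%:E)} /\
  {ae Pr, forall w : Omega, ~ quasi_uniform (xt w)}.
Proof.
move=> xt; have A0 : 0 <= A := le_trans ler01 hA.
pose good w := exists (g : nat -> R) (n0 : nat),
  [/\ (forall n, (n0 <= n)%N -> 0 < separation (xt w) n),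
      (forall n, (n0 <= n)%N -> 0 < g n /\ mesh_ratio (xt w) n = (g n)%:E),
      log_growth (fun n => ln (separation (xt w) n)) (- (3 / (2 * d%:R))) &
      log_growth (fun n => ln (g n)) (1 / (2 * d%:R))].
have ae_good : {ae Pr, forall w, good w}.
  have ae_far := ae_far_pairs hb hpi hx hcut hd A0 hcoinc.
  have ae_close := ae_close_pairs hb hpi hx hcut.
  apply: filterS (filterI ae_far ae_close) => w [far close].
  have cover k n : (b ^ (d * k + t) <= n)%N ->
      covering_radius (xt w) n <= (b%:R ^+ k)^-1.
    exact: (covering_radius_net hb hx).
  have [n0 sep_gt0] := separation_gt0 hb hd far.
  have cov_gt0 := covering_radius_gt0 hb hd (xt w).
  have sep_growth := log_growth_separation hb hd far close.
  have cov_growth := log_growth_covering_radius hb hd cover.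
  exists (fun n => 2 * covering_radius (xt w) n / separation (xt w) n), (maxn 1 n0).
  split=> //.
  - by move=> n; rewrite geq_max => /andP[_ /sep_gt0].
  - move=> n; rewrite geq_max => /andP[/cov_gt0 hc /sep_gt0 hs].
    by rewrite /mesh_ratio gt_eqF// divr_gt0 ?mulr_gt0.
  move=> eps e0.
  have [C [n1 H]] := log_growthB cov_growth sep_growth e0.
  exists (C + ln 2), (maxn n1 (maxn 1 n0)) => n.
  rewrite !geq_max => /and3P[/H hn /cov_gt0 hc /sep_gt0 hs].
  rewrite lnM ?posrE ?mulr_gt0 ?invr_gt0// lnV ?posrE// lnM ?posrE//.
  have -> : ln 2 + ln (covering_radius (xt w) n) - ln (separation (xt w) n)
      - 1 / (2 * d%:R) * ln n%:R
    = (ln (covering_radius (xt w) n) - ln (separation (xt w) n)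
      - (- d%:R^-1 - - (3 / (2 * d%:R))) * ln n%:R) + ln 2.
    by field; rewrite pnatr_eq0 -lt0n.
  apply: (le_trans (ler_normD _ _)); rewrite addrA lerD// ger0_norm//.
  by rewrite ln_ge0// ler1n.
have d0 : 0 < d%:R :> R by rewrite ltr0n.
split; apply: filterS ae_good => w [g [n0 [sep_gt0 meshE sep_growth g_growth]]].
  split; last exact: lne_ratio_cvg meshE g_growth.
  by apply: lne_ratio_cvg sep_growth => n /sep_gt0.
rewrite /quasi_uniform => qu.
have mesh_le n : (maxn 2 n0 <= n)%N -> ((g n)%:E <= ereal_sup
    [set mesh_ratio (xt w) N | N in [set N | (2 <= N)%N]])%E.
  rewrite geq_max => /andP[n2 /meshE[_ <-]].
  by apply: ereal_sup_ubound; exists n.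
move: qu mesh_le; case: ereal_sup => [c _ mesh_le|//|_ mesh_le]; last first.
  by have := mesh_le _ (leqnn _).
have a0 : 0 < 1 / (2 * d%:R) :> R by rewrite divr_gt0// mulr_gt0.
apply: (unbounded_of_log_growth a0 g_growth (n0 := maxn 2 n0) (c := c)).
  by move=> n; rewrite geq_max => /andP[_ /meshE[]].
by move=> n /mesh_le; rewrite lee_fin.
Qed.
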